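(* Let $p$ be a Nehari function with $0\le\mu<1$, where $\mu=\lim_{x\to1-}(1-x^2)^2p(x)$, and let $C>2$ be a constant. Let $f$ be analytic and locally univalent in the unit disk $\mathbb{D}$, and suppose that $$|\mathcal{S}f(z)|\le C\,p(|z|),\qquad z\in\mathbb{D}.$$ Then $f$ is uniformly locally univalent with respect to the hyperbolic metric. If moreover $C\mu<2$, then the valence of $f$ is finite and has a bound independent of $f$ (that is, there is a finite number $N$ depending only on $C$ and $p$ such that every such $f$ has valence at most $N$).
   Context: $\mathbb{D}=\{z\in\mathbb{C}:|z|<1\}$. The Schwarzian derivative of an analytic locally univalent function $f$ is $\mathcal{S}f=(f''/f')'-\tfrac12(f''/f')^2$. A Nehari function is a positive continuous even function $p$ on $(-1,1)$ such that $(1-x^2)^2p(x)$ is nonincreasing on $[0,1)$ and no nontrivial solution $u$ of the differential equation $u''+pu=0$ has more than one zero in $(-1,1)$. Since $(1-x^2)^2p(x)$ is positive and nonincreasing on $[0,1)$, the limit $\mu=\lim_{x\to1-}(1-x^2)^2p(x)$ exists and $\mu\ge 0$. The hyperbolic metric on $\mathbb{D}$ is $d(\alpha,\beta)=\frac12\log\frac{1+\rho(\alpha,\beta)}{1-\rho(\alpha,\beta)}$, where $\rho(\alpha,\beta)=\left|\frac{\alpha-\beta}{1-\overline{\alpha}\beta}\right|$. A function $f$ on $\mathbb{D}$ is uniformly locally univalent (with respect to the hyperbolic metric) if there is a constant $\varepsilon>0$ such that $d(\alpha,\beta)\ge\varepsilon$ for every pair of distinct points $\alpha,\beta\in\mathbb{D}$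 with $f(\alpha)=f(\beta)$. The valence of a function $f$ analytic in $\mathbb{D}$ is $\sup_{w\in\mathbb{C}}n(f,w)$, where $n(f,w)\le\infty$ is the number of points $z\in\mathbb{D}$ with $f(z)=w$. *)

(* Defs.v *)
From Stdlib Require Export Reals List.
From Coquelicot Require Export Coquelicot.
Open Scope R_scope.

Definition unit_disk (z : C) : Prop := Cmod z < 1.

(* Complex analyticity: locally the sum of a convergent power series. *)
Definition analytic_on_disk (f : C -> C) : Prop :=
  forall z0 : C, unit_disk z0 ->
    exists (a : nat -> C) (r : R), 0 < r /\
      forall z : C, Cmod (z - z0)%C < r ->
        is_pseries (K := C_AbsRing) (V := C_NormedModule) a (z - z0)%C (f z).

Definition locally_univalent_on_disk (f : C -> C) : Prop :=
  forall z0 : C, unit_disk z0 ->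
    exists r : R, 0 < r /\
      forall z w : C, unit_disk z -> unit_disk w ->
        Cmod (z - z0)%C < r -> Cmod (w - z0)%C < r ->
        f z = f w -> z = w.

(* [C_derive] is a total operator computed along the real direction; by
   [is_C_derive_unique] it is the complex derivative wherever that exists, in
   particular for [f] and its derivatives when [f] is analytic on the disk. *)
Definition pre_schwarzian (f : C -> C) (z : C) : C :=
  (C_derive (C_derive f) z / C_derive f z)%C.

Definition schwarzian (f : C -> C) (z : C) : C :=
  (C_derive (pre_schwarzian f) z
   - RtoC (1 / 2) * (pre_schwarzian f z * pre_schwarzian f z))%C.

Definition solves_ode (p u : R -> R) : Prop :=
  forall x : R, -1 < x < 1 ->
    ex_derive u x /\ ex_derive (Derive u) x /\
    Derive (Derive u) x + p x * u x = 0.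

(* Only the values of [p] on (-1,1) matter. *)
Definition nehari_function (p : R -> R) : Prop :=
  (forall x, -1 < x < 1 -> 0 < p x) /\
  (forall x, -1 < x < 1 -> continuous p x) /\
  (forall x, -1 < x < 1 -> p (- x) = p x) /\
  (forall x y, 0 <= x -> x <= y -> y < 1 ->
     (1 - y ^ 2) ^ 2 * p y <= (1 - x ^ 2) ^ 2 * p x) /\
  (forall u : R -> R, solves_ode p u ->
     (exists x, -1 < x < 1 /\ u x <> 0) ->
     forall x y, -1 < x < 1 -> -1 < y < 1 ->
       u x = 0 -> u y = 0 -> x = y).

Definition pseudo_hyperbolic (a b : C) : R :=
  Cmod ((a - b) / (RtoC 1 - Cconj a * b))%C.

Definition hyperbolic_dist (a b : C) : R :=
  1 / 2 * ln ((1 + pseudo_hyperbolic a b) / (1 - pseudo_hyperbolic a b)).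

Definition uniformly_locally_univalent (f : C -> C) : Prop :=
  exists eps : R, 0 < eps /\
    forall a b : C, unit_disk a -> unit_disk b -> a <> b -> f a = f b ->
      eps <= hyperbolic_dist a b.

(* Number of elements of [A], [p_infty] when [A] is infinite: the supremum of
   the sizes of its finite subsets. *)
Definition card (A : C -> Prop) : Rbar :=
  Lub_Rbar (fun x : R => exists l : list C,
    NoDup l /\ (forall z, In z l -> A z) /\ x = INR (length l)).

Definition preimage_count (f : C -> C) (w : C) : Rbar :=
  card (fun z => unit_disk z /\ f z = w).

Definition valence (f : C -> C) : Rbar :=
  Rbar_lub (fun v : Rbar => exists w : C, v = preimage_count f w).

(* Main.v *)
Require Import Defs.
From Stdlib Require Import Psatz Classical ZArith.

(** Let M = c p(0). Since (1-x^2)^2 p(x) is nonincreasing, the Schwarzian derivative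
    satisfies (1-|z|^2)^2 |Sf(z)| <= M throughout the disk, and if c mu < 2 it satisfies
    (1-|z|^2)^2 |Sf(z)| <= 2 in an annulus r0 <= |z| < 1.

    Suppose f(a) = f(b) with a and b distinct, and let g be the hyperbolic geodesic from
    a to b, parametrized on [0,t] by a Moebius map, t being the pseudo-hyperbolic
    distance. The curve F = f o g has Schwarzian derivative S = (Sf o g) g'^2, and the
    isometry property 1 - |g|^2 = |g'| (1-x^2) carries the bounds on Sf over to
    (1-x^2)^2 |S|. Now u = (F - f(a)) / sqrt F' is a solution of u'' + (S/2) u = 0
    with zeros at both ends. If sigma is a solution on [0,t] of
    sigma' + sigma^2 <= -|S|/2, then Re (conj u u') - sigma |u|^2 is nondecreasing on
    [0,t], vanishes at both ends and has positive derivative at 0, which is absurd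
    ([no_second_zero], [geodesic_comparison]).

    With sigma = -2Mx this excludes t <= 1/(2+2M), which is uniform local univalence
    with a constant depending on M alone ([pseudo_hyperbolic_separation]). With
    sigma = -x/(1-x^2), that is Nehari's comparison function sqrt (1-x^2), it excludes
    every geodesic contained in the annulus. So if a is close to the unit circle, the
    geodesic from a to b enters |z| < r0, and as Euclidean distance to a increases along
    it, b is far from a. In all cases |a - b| is bounded below by a constant depending
    on M and r0 ([euclidean_separation]), and a pigeonhole count bounds the valence
    ([packing]).

    The argument divides by f'. That f' has no zero follows from the bound on Sf
    ([derivative_nonzero]): 1 / sqrt f' solves a linear equation with locally bounded
    coefficient, hence is locally bounded. The real-variable computations are done with
    F, V = F', h = F''/F' and S, through |u|^2 = |F|^2/|V|, so that no square root
    of a complex function is ever chosen. *)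

(** * Complex derivatives and termwise differentiation of power series *)

(** The values are taken in [AbsRing_NormedModule C_AbsRing], the structure for
    which the generic product and chain rules are stated. *)
Definition Cdiff (f : C -> C) (z l : C) :=
  is_derive (K := C_AbsRing) (V := AbsRing_NormedModule C_AbsRing) f z l.

Lemma Cdiff_iff (f : C -> C) (z l : C) :
  Cdiff f z l <->
  (forall eps, 0 < eps -> exists d, 0 < d /\ forall h : C, Cmod h < d ->
     Cmod (f (z + h) - f z - l * h)%C <= eps * Cmod h).
Proof.
  split.
  - intros [_ H] eps Heps.
    destruct (H z (fun P HP => HP) (mkposreal eps Heps)) as [d Hd].
    exists d; split; [apply cond_pos|]. intros h Hh.
    specialize (Hd (z + h)%C).
    replace (f (z + h) - f z - l * h)%C
      with (f (z + h) - f z - (z + h - z) * l)%C by ring.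
    replace (Cmod h) with (Cmod (z + h - z)%C) by (f_equal; ring).
    apply Hd. change (Cmod (z + h - z)%C < d).
    replace (z + h - z)%C with h by ring. exact Hh.
  - intros H; split; [apply is_linear_scal_l|].
    intros x Hx eps.
    assert (Hzx := is_filter_lim_locally_unique (V := AbsRing_NormedModule C_AbsRing) z x Hx).
    subst x.
    destruct (H eps (cond_pos eps)) as [d [Hd Hb]].
    exists (mkposreal d Hd). intros y Hy. change C in y.
    specialize (Hb (y - z)%C Hy).
    replace (z + (y - z))%C with (y : C) in Hb by (change (@eq C y (z + (y - z))%C); ring).
    rewrite (Cmult_comm l) in Hb. exact Hb.
Qed.

Lemma Cdiff_inv (z : C) : z <> 0%C ->
  Cdiff Cinv z (- / (z * z))%C.
Proof.
  intros Hz. apply Cdiff_iff. intros eps Heps.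
  assert (Hm := proj1 (Cmod_gt_0 z) Hz).
  set (m := Cmod z) in *.
  assert (Hm3 : 0 < m * m * m) by (repeat apply Rmult_lt_0_compat; lra).
  exists (Rmin (m / 2) (eps * (m * m * m) / 2)); split.
  { apply Rmin_glb_lt; [lra|]. apply Rdiv_lt_0_compat; [nra|lra]. }
  intros h Hh.
  assert (H1 := Rlt_le_trans _ _ _ Hh (Rmin_l _ _)).
  assert (H2 := Rlt_le_trans _ _ _ Hh (Rmin_r _ _)).
  assert (H3 : m / 2 < Cmod (z + h)%C).
  { assert (T := Cmod_triangle (z + h)%C (- h)%C).
    rewrite Cmod_opp in T. replace (z + h + - h)%C with z in T by ring.
    fold m in T. lra. }
  assert (Hzh : (z + h)%C <> 0%C) by (apply Cmod_gt_0; lra).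
  replace (/ (z + h) - / z - - / (z * z) * h)%C
    with (h * h * / (z * z * (z + h)))%C by (field; auto).
  rewrite !Cmod_mult, Cmod_inv, !Cmod_mult; [|repeat apply Cmult_neq_0; auto].
  fold m. set (q := Cmod (z + h)%C) in *. set (k := Cmod h) in *.
  assert (Hk : 0 <= k) by apply Cmod_ge_0.
  assert (Hq : 0 < m * m * q) by (repeat apply Rmult_lt_0_compat; lra).
  apply (Rmult_le_reg_r (m * m * q)); [exact Hq|].
  rewrite Rmult_assoc, Rinv_l, Rmult_1_r by lra.
  assert (m * m * (m / 2) <= m * m * q) by (apply Rmult_le_compat_l; nra).
  rewrite (Rmult_comm eps), Rmult_assoc. apply Rmult_le_compat_l; [lra|]. nra.
Qed.

Lemma is_series_C_iff (b : nat -> C) (l : C) :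
  is_series (K := C_AbsRing) (V := C_NormedModule) b l <->
  is_series (fun n => Re (b n)) (Re l) /\ is_series (fun n => Im (b n)) (Im l).
Proof.
  assert (HR : forall n, sum_n (fun n => Re (b n)) n
      = Re (sum_n (G := C_AbelianMonoid) b n)).
  { induction n; [rewrite !sum_O; reflexivity|].
    rewrite !sum_Sn, IHn. reflexivity. }
  assert (HI : forall n, sum_n (fun n => Im (b n)) n
      = Im (sum_n (G := C_AbelianMonoid) b n)).
  { induction n; [rewrite !sum_O; reflexivity|].
    rewrite !sum_Sn, IHn. reflexivity. }
  unfold is_series. split.
  - intros H; split; intros P [eps HP].
    + destruct (H (fun w => ball (Re l) eps (Re w))) as [N HN].
      { exists eps; intros w Hw; apply Hw. }
      exists N; intros n Hn. apply HP. rewrite HR. apply (HN n Hn).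
    + destruct (H (fun w => ball (Im l) eps (Im w))) as [N HN].
      { exists eps; intros w Hw; apply Hw. }
      exists N; intros n Hn. apply HP. rewrite HI. apply (HN n Hn).
  - intros [H1 H2] P [eps HP].
    destruct (H1 _ (locally_ball (Re l) eps)) as [N1 HN1].
    destruct (H2 _ (locally_ball (Im l) eps)) as [N2 HN2].
    exists (max N1 N2). intros n Hn. apply HP. split.
    + change (ball (Re l) eps (Re (sum_n (G := C_AbelianMonoid) b n))).
      rewrite <- HR. apply HN1. lia.
    + change (ball (Im l) eps (Im (sum_n (G := C_AbelianMonoid) b n))).
      rewrite <- HI. apply HN2. lia.
Qed.

Lemma Rabs_Im_le (z : C) : Rabs (Im z) <= Cmod z.
Proof. eapply Rle_trans; [apply Rmax_r|apply Rmax_Cmod]. Qed.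

Lemma Cmod_le_parts (z : C) : Cmod z <= Rabs (Re z) + Rabs (Im z).
Proof.
  replace z with (RtoC (Re z) + Ci * RtoC (Im z))%C at 1
    by (destruct z as [x y]; unfold Ci, RtoC, Cplus, Cmult; simpl; f_equal; ring).
  eapply Rle_trans; [apply Cmod_triangle|].
  rewrite Cmod_mult, !Cmod_R, Cmod_Ci. lra.
Qed.

Lemma ex_series_C_abs (b : nat -> C) (beta : nat -> R) :
  (forall n, Cmod (b n) <= beta n) -> ex_series beta ->
  exists l, is_series (K := C_AbsRing) (V := C_NormedModule) b l.
Proof.
  intros H E.
  assert (E1 : ex_series (fun n => Re (b n))).
  { apply (ex_series_le (V := R_CompleteNormedModule)) with beta; auto.
    intros n. eapply Rle_trans; [apply (re_le_Cmod (b n))|auto]. }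
  assert (E2 : ex_series (fun n => Im (b n))).
  { apply (ex_series_le (V := R_CompleteNormedModule)) with beta; auto.
    intros n. eapply Rle_trans; [apply (Rabs_Im_le (b n))|auto]. }
  destruct E1 as [l1 H1], E2 as [l2 H2].
  exists (l1, l2). apply is_series_C_iff. split; assumption.
Qed.

Lemma Rabs_series_le (b beta : nat -> R) (l s : R) :
  (forall n, Rabs (b n) <= beta n) -> is_series b l -> is_series beta s ->
  Rabs l <= s.
Proof.
  intros H Hb Hs.
  assert (E : ex_series (fun n => Rabs (b n))).
  { apply (ex_series_le (V := R_CompleteNormedModule)) with beta; [|exists s; auto].
    intros n. change (Rabs (Rabs (b n)) <= beta n). rewrite Rabs_Rabsolu. auto. }
  rewrite <- (is_series_unique _ _ Hb), <- (is_series_unique _ _ Hs).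
  eapply Rle_trans; [apply Series_Rabs, E|].
  apply Series_le; [|exists s; auto].
  intros n; split; [apply Rabs_pos|auto].
Qed.

(** The factor 2, the price of bounding real and imaginary parts separately, is
    harmless: the bound serves only to show that a remainder is O(|h|^2). *)
Lemma Cmod_series_le (b : nat -> C) (beta : nat -> R) (l : C) (s : R) :
  (forall n, Cmod (b n) <= beta n) ->
  is_series (K := C_AbsRing) (V := C_NormedModule) b l -> is_series beta s ->
  Cmod l <= 2 * s.
Proof.
  intros H Hb Hs. apply is_series_C_iff in Hb. destruct Hb as [H1 H2].
  assert (A1 : Rabs (Re l) <= s).
  { apply Rabs_series_le with (2 := H1) (3 := Hs).
    intros n. eapply Rle_trans; [apply re_le_Cmod|auto]. }
  assert (A2 : Rabs (Im l) <= s).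
  { apply Rabs_series_le with (2 := H2) (3 := Hs).
    intros n. eapply Rle_trans; [apply Rabs_Im_le|auto]. }
  assert (T := Cmod_le_parts l). lra.
Qed.

Lemma pow_n_Cpow (z : C) (n : nat) : pow_n (K := C_Ring) z n = (z ^ n)%C.
Proof. induction n; [reflexivity|]. simpl. rewrite IHn. reflexivity. Qed.

Lemma is_pseries_C_iff (a : nat -> C) (z l : C) :
  is_pseries (K := C_AbsRing) (V := C_NormedModule) a z l <->
  is_series (K := C_AbsRing) (V := C_NormedModule) (fun n => z ^ n * a n)%C l.
Proof.
  unfold is_pseries.
  assert (E := fun n => f_equal (fun w => (w * a n)%C) (pow_n_Cpow z n)).
  split; apply is_series_ext; intros n; [exact (E n)|exact (eq_sym (E n))].
Qed.

Lemma is_lim_seq_0_bounded (u : nat -> R) : is_lim_seq u 0 ->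
  exists M, forall n, Rabs (u n) <= M.
Proof.
  intros H.
  destruct (maj_by_pos u) as [M [_ HM]].
  - exists 0. apply is_lim_seq_Reals, H.
  - exists M; auto.
Qed.

(** Transfers convergence of a complex power series on a disk to the radius of
    convergence of the real series of moduli, so that the real theory of termwise
    differentiation supplies the majorants: at a real point t between s and r the
    terms are bounded. *)
Lemma CV_radius_Cmod (a : nat -> C) (r : R) : 
  (forall z, Cmod z < r -> exists l, is_pseries (K := C_AbsRing) (V := C_NormedModule) a z l) ->
  forall s, 0 <= s < r -> Rbar_lt s (CV_radius (fun n => Cmod (a n))).
Proof.
  intros H s Hs.
  set (t := (s + r) / 2).
  assert (Ht : Cmod (RtoC t) < r).
  { rewrite Cmod_R, Rabs_pos_eq; unfold t; lra. }
  destruct (H _ Ht) as [l Hl]. apply (proj1 (is_pseries_C_iff _ _ _)), is_series_C_iff in Hl.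
  destruct Hl as [H1 H2].
  destruct (is_lim_seq_0_bounded _ (ex_series_lim_0 _ (ex_intro _ _ H1))) as [M1 HM1].
  destruct (is_lim_seq_0_bounded _ (ex_series_lim_0 _ (ex_intro _ _ H2))) as [M2 HM2].
  apply Rbar_lt_le_trans with t; [simpl; unfold t; lra|].
  apply (proj1 (CV_radius_bounded (fun n => Cmod (a n)))).
  exists (M1 + M2). intros n. cbv beta.
  assert (T := Cmod_le_parts (RtoC t ^ n * a n)%C).
  specialize (HM1 n). specialize (HM2 n). cbv beta in HM1, HM2.
  rewrite Cmod_mult, Cmod_pow, Cmod_R, (Rabs_pos_eq t) in T by (unfold t; lra).
  rewrite Rabs_pos_eq.
  - lra.
  - apply Rmult_le_pos; [apply Cmod_ge_0|apply pow_le; unfold t; lra].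
Qed.

(** The factor (k+1) k R0^(k-1) is the second derivative of x^(k+1) at R0;
    induction through the identity
    (w+h)^(k+1) - w^(k+1) - (k+1) w^k h
      = (w+h) ((w+h)^k - w^k - k w^(k-1) h) + k w^(k-1) h^2. *)
Lemma Cmod_pow_remainder (w h : C) (R0 : R) (k : nat) :
  Cmod w <= R0 -> Cmod (w + h)%C <= R0 ->
  Cmod ((w + h) ^ S k - w ^ S k - INR (S k) * w ^ k * h)%C
    <= INR (S k) * INR k * R0 ^ pred k * Cmod h ^ 2.
Proof.
  intros Hw Hwh.
  assert (HR : 0 <= R0) by (assert (T := Cmod_ge_0 w); lra).
  induction k as [|k IH].
  - replace ((w + h) ^ 1 - w ^ 1 - INR 1 * w ^ 0 * h)%C with (RtoC 0)
      by (simpl; ring).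
    rewrite Cmod_0. simpl. lra.
  - replace ((w + h) ^ S (S k) - w ^ S (S k) - INR (S (S k)) * w ^ S k * h)%C
      with ((w + h) * ((w + h) ^ S k - w ^ S k - INR (S k) * w ^ k * h)
            + INR (S k) * w ^ k * (h * h))%C
      by (rewrite (S_INR (S k)), RtoC_plus, !(Cpow_S _ (S k)), (Cpow_S w k); ring).
    eapply Rle_trans; [apply Cmod_triangle|].
    rewrite !Cmod_mult, Cmod_R, (Rabs_pos_eq (INR _)), Cmod_pow by apply pos_INR.
    assert (P1 : Cmod w ^ k <= R0 ^ k).
    { apply pow_incr; split; [apply Cmod_ge_0|exact Hw]. }
    assert (Hh := Cmod_ge_0 h).
    assert (Hk : 0 <= INR k) by apply pos_INR.
    assert (Q1 : Cmod (w + h)%C * Cmod ((w + h) ^ S k - w ^ S k - INR (S k) * w ^ k * h)%C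
      <= R0 * (INR (S k) * INR k * R0 ^ pred k * Cmod h ^ 2)).
    { apply Rmult_le_compat; auto using Cmod_ge_0. }
    assert (Q2 : INR (S k) * Cmod w ^ k * (Cmod h * Cmod h)
       <= INR (S k) * R0 ^ k * (Cmod h * Cmod h)).
    { apply Rmult_le_compat_r; [nra|].
      apply Rmult_le_compat_l; [apply pos_INR|exact P1]. }
    assert (Q3 : R0 * (INR (S k) * INR k * R0 ^ pred k * Cmod h ^ 2)
       = INR (S k) * INR k * R0 ^ k * Cmod h ^ 2).
    { destruct k; simpl; ring. }
    assert (Q4 : 0 <= R0 ^ k) by (apply pow_le; exact HR).
    rewrite Q3 in Q1. simpl pred. rewrite !S_INR in *.
    assert (0 <= (INR k + 1) * R0 ^ k * Cmod h ^ 2).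
    { repeat apply Rmult_le_pos; try lra; apply pow_le; lra. }
    simpl pow in *. nra.
Qed.

(** Termwise differentiation. By the bound on the remainder of each monomial, the
    remainder of the sum is at most a multiple of |h|^2, the multiple being a
    value of the twice differentiated series of moduli at a radius R0 between
    |z - z0| and r. *)
Lemma pseries_derive (a : nat -> C) (r : R) (f : C -> C) (z0 : C) :
  (forall z, Cmod (z - z0)%C < r ->
     is_pseries (K := C_AbsRing) (V := C_NormedModule) a (z - z0)%C (f z)) ->
  forall z, Cmod (z - z0)%C < r -> exists l,
    is_pseries (K := C_AbsRing) (V := C_NormedModule)
      (fun n => INR (S n) * a (S n))%C (z - z0)%C l /\
    Cdiff f z l.
Proof.
  intros Hf z Hz.
  set (w := (z - z0)%C) in *.
  assert (Hw0 := Cmod_ge_0 w).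
  set (R0 := (Cmod w + r) / 2).
  assert (HR0 : Cmod w < R0 < r) by (unfold R0; lra).
  assert (HCV : Rbar_lt R0 (CV_radius (fun n => Cmod (a n)))).
  { apply CV_radius_Cmod with r; [|lra]. intros y Hy.
    exists (f (z0 + y)%C). replace y with (z0 + y - z0)%C at 1 by ring.
    apply Hf. replace (z0 + y - z0)%C with y by ring. exact Hy. }
  assert (E1 : ex_series (fun k => INR (S k) * Cmod (a (S k)) * R0 ^ k)).
  { rewrite <- CV_radius_derive in HCV.
    rewrite <- (Rabs_pos_eq R0) in HCV by lra.
    eapply ex_series_ext; [|apply CV_disk_inside, HCV].
    intros n. unfold PS_derive. cbv beta. rewrite !Rabs_mult.
    rewrite (Rabs_pos_eq (INR _)) by apply pos_INR.
    rewrite (Rabs_pos_eq (Cmod _)) by apply Cmod_ge_0.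
    rewrite (Rabs_pos_eq (_ ^ _)) by (apply pow_le; lra). reflexivity. }
  assert (E2 : ex_series (fun k => Cmod (a (S k)) * (INR (S k) * INR k * R0 ^ pred k))).
  { apply ex_series_incr_1.
    rewrite <- CV_radius_derive, <- CV_radius_derive in HCV.
    rewrite <- (Rabs_pos_eq R0) in HCV by lra.
    eapply ex_series_ext; [|apply CV_disk_inside, HCV].
    intros n. unfold PS_derive. cbv beta. rewrite !Rabs_mult.
    rewrite !(Rabs_pos_eq (INR _)) by apply pos_INR.
    rewrite (Rabs_pos_eq (Cmod _)) by apply Cmod_ge_0.
    rewrite (Rabs_pos_eq (_ ^ _)) by (apply pow_le; lra).
    simpl pred. match goal with |- @eq _ ?x ?y => change (@eq R x y) end. ring. }
  assert (E3 : forall n, Cmod (w ^ n * (INR (S n) * a (S n)))%C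
      <= INR (S n) * Cmod (a (S n)) * R0 ^ n).
  { intros n. rewrite !Cmod_mult, Cmod_pow, Cmod_R, Rabs_pos_eq by apply pos_INR.
    rewrite Rmult_comm. apply Rmult_le_compat_l.
    - apply Rmult_le_pos; [apply pos_INR|apply Cmod_ge_0].
    - apply pow_incr; lra. }
  destruct (ex_series_C_abs _ _ E3 E1) as [l Hl].
  exists l. split; [apply is_pseries_C_iff; exact Hl|].
  destruct E2 as [s Hs].
  assert (Hs0 : 0 <= s).
  { apply Rle_trans with (Rabs s); [apply Rabs_pos|].
    apply Rabs_series_le with (2 := Hs) (3 := Hs). intros n. apply Req_le, Rabs_pos_eq.
    apply Rmult_le_pos; [apply Cmod_ge_0|].
    repeat apply Rmult_le_pos; try apply pos_INR. apply pow_le; lra. }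
  apply Cdiff_iff. intros eps Heps.
  exists (Rmin (R0 - Cmod w) (eps / (2 * s + 1))). split.
  { apply Rmin_glb_lt; [lra|]. apply Rdiv_lt_0_compat; lra. }
  intros h Hh.
  assert (D1 := Rlt_le_trans _ _ _ Hh (Rmin_l _ _)).
  assert (D2 := Rlt_le_trans _ _ _ Hh (Rmin_r _ _)).
  assert (Hwh : Cmod (w + h)%C <= R0).
  { eapply Rle_trans; [apply Cmod_triangle|lra]. }
  assert (S1 := Hf z Hz). fold w in S1.
  assert (S2 := Hf (z + h)%C). replace (z + h - z0)%C with (w + h)%C in S2 by (unfold w; ring).
  specialize (S2 ltac:(lra)).
  apply (proj1 (is_pseries_C_iff _ _ _)) in S1, S2.
  assert (S3 := is_series_minus _ _ _ _ S2 S1).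
  assert (S4 : is_series (K := C_AbsRing) (V := C_NormedModule)
     (fun k => (w + h) ^ S k * a (S k) - w ^ S k * a (S k))%C (f (z + h) - f z)%C).
  { apply (is_series_incr_1 (K := C_AbsRing) (V := C_NormedModule)
      (fun k => (w + h) ^ k * a k - w ^ k * a k)%C).
    match goal with |- is_series _ ?x =>
      replace x with (f (z + h) - f z)%C; [exact S3|] end.
    change (@eq C (f (z + h) - f z)%C (f (z + h) - f z + (1 * a O - 1 * a O))%C). ring. }
  assert (S5 := is_series_minus _ _ _ _ S4 (is_series_scal_l (K := C_AbsRing) h _ _ Hl)).
  assert (Hh0 := Cmod_ge_0 h).
  assert (S6 : is_series (fun k => Cmod (a (S k)) * (INR (S k) * INR k * R0 ^ pred k)
      * Cmod h ^ 2) (s * Cmod h ^ 2)) by (apply is_series_scal_r, Hs).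
  replace (l * h)%C with (h * l)%C by ring.
  eapply Rle_trans.
  { apply (fun H => Cmod_series_le _ _ _ _ H S5 S6).
    intros k. eapply Rle_trans; [|rewrite Rmult_assoc; apply Rmult_le_compat_l;
      [apply Cmod_ge_0|apply (Cmod_pow_remainder w h R0 k); [lra|exact Hwh]]].
    rewrite <- Cmod_mult. apply Req_le. f_equal.
    change (@eq C ((w + h) ^ S k * a (S k) - w ^ S k * a (S k)
       - h * (w ^ k * (INR (S k) * a (S k))))%C
       (a (S k) * ((w + h) ^ S k - w ^ S k - INR (S k) * w ^ k * h))%C). ring. }
  assert (D3 : Cmod h * (2 * s + 1) <= eps).
  { apply (Rmult_lt_compat_r (2 * s + 1)) in D2; [|lra].
    unfold Rdiv in D2. rewrite Rmult_assoc, Rinv_l in D2; lra. }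
  simpl. nra.
Qed.

Lemma Cdiff_unique (f : C -> C) (z l : C) : Cdiff f z l -> C_derive f z = l.
Proof.
  intros H. apply is_C_derive_unique. destruct H as [H1 H2]. split; [|exact H2].
  apply is_linear_scal_l.
Qed.

Lemma analytic_Cdiff (f : C -> C) : analytic_on_disk f ->
  forall z, unit_disk z -> Cdiff f z (C_derive f z).
Proof.
  intros Hf z Hz. destruct (Hf z Hz) as [a [r [Hr H]]].
  destruct (pseries_derive a r f z H z) as [l [_ Hl]].
  { replace (z - z)%C with (RtoC 0) by ring. rewrite Cmod_0. exact Hr. }
  unfold Cdiff. rewrite (Cdiff_unique f z l Hl). exact Hl.
Qed.

Lemma analytic_C_derive (f : C -> C) : analytic_on_disk f ->
  analytic_on_disk (C_derive f).
Proof.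
  intros Hf z0 Hz0. destruct (Hf z0 Hz0) as [a [r [Hr H]]].
  exists (fun n => INR (S n) * a (S n))%C, r. split; [exact Hr|].
  intros z Hz. destruct (pseries_derive a r f z0 H z Hz) as [l [Hl Hd]].
  rewrite (Cdiff_unique f z l Hd). exact Hl.
Qed.

(** * Curves in the plane and the Schwarzian derivative along them *)

(** Derivative of a complex curve in its real parameter, in components so that
    real calculus applies directly. *)
Definition curve_deriv (g : R -> C) (x : R) (v : C) : Prop :=
  is_derive (fun t => Re (g t)) x (Re v) /\ is_derive (fun t => Im (g t)) x (Im v).

Lemma is_derive_R_iff (f : R -> R) (x l : R) :
  is_derive f x l <->
  (forall eps, 0 < eps -> exists d, 0 < d /\ forall h, Rabs h < d ->
     Rabs (f (x + h) - f x - h * l) <= eps * Rabs h).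
Proof.
  split.
  - intros [_ H] eps Heps.
    destruct (H x (fun P HP => HP) (mkposreal eps Heps)) as [d Hd].
    exists d; split; [apply cond_pos|]. intros h Hh.
    specialize (Hd (x + h)).
    replace (f (x + h) - f x - h * l)
      with (f (x + h) - f x - (x + h - x) * l) by ring.
    replace (Rabs h) with (Rabs (x + h - x)) by (f_equal; ring).
    apply Hd. change (Rabs (x + h - x) < d).
    replace (x + h - x) with h by ring. exact Hh.
  - intros H; split; [apply is_linear_scal_l|].
    intros y0 Hy0 eps.
    assert (Hxy := is_filter_lim_locally_unique (V := R_NormedModule) x y0 Hy0).
    subst y0.
    destruct (H eps (cond_pos eps)) as [d [Hd Hb]].
    exists (mkposreal d Hd). intros y Hy. change R in y.
    specialize (Hb (y - x) Hy).
    replace (x + (y - x)) with (y : R) in Hb by (change (@eq R y (x + (y - x))); ring).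
    exact Hb.
Qed.

Lemma curve_deriv_iff (g : R -> C) (x : R) (v : C) :
  curve_deriv g x v <->
  (forall eps, 0 < eps -> exists d, 0 < d /\ forall h, Rabs h < d ->
     Cmod (g (x + h)%R - g x - h * v)%C <= eps * Rabs h).
Proof.
  assert (HR : forall h, Re (g (x + h)%R - g x - h * v)%C
     = Re (g (x + h)) - Re (g x) - h * Re v)
    by (intros h; unfold Re, Im, Cminus, Cplus, Copp, Cmult, RtoC; simpl; ring).
  assert (HI : forall h, Im (g (x + h)%R - g x - h * v)%C
     = Im (g (x + h)) - Im (g x) - h * Im v)
    by (intros h; unfold Re, Im, Cminus, Cplus, Copp, Cmult, RtoC; simpl; ring).
  split.
  - intros [H1 H2] eps Heps.
    destruct (proj1 (is_derive_R_iff _ _ _) H1 (eps / 2)) as [d1 [Hd1 K1]]; [lra|].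
    destruct (proj1 (is_derive_R_iff _ _ _) H2 (eps / 2)) as [d2 [Hd2 K2]]; [lra|].
    exists (Rmin d1 d2). split; [apply Rmin_glb_lt; lra|]. intros h Hh.
    specialize (K1 h (Rlt_le_trans _ _ _ Hh (Rmin_l _ _))).
    specialize (K2 h (Rlt_le_trans _ _ _ Hh (Rmin_r _ _))).
    eapply Rle_trans; [apply Cmod_le_parts|]. rewrite HR, HI. lra.
  - intros H. split; apply is_derive_R_iff; intros eps Heps;
      destruct (H eps Heps) as [d [Hd K]]; exists d; split; auto; intros h Hh;
      specialize (K h Hh); (eapply Rle_trans; [|exact K]).
    + rewrite <- HR. apply re_le_Cmod.
    + rewrite <- HI. apply Rabs_Im_le.
Qed.

Lemma curve_deriv_comp (f : C -> C) (g : R -> C) (x : R) (l v : C) :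
  Cdiff f (g x) l -> curve_deriv g x v -> curve_deriv (fun t => f (g t)) x (l * v)%C.
Proof.
  intros Hf Hg. apply curve_deriv_iff. intros eps Heps.
  assert (Hl := Cmod_ge_0 l). assert (Hv := Cmod_ge_0 v).
  set (e1 := eps / (2 * (Cmod v + 1))).
  assert (He1 : 0 < e1) by (apply Rdiv_lt_0_compat; lra).
  destruct (proj1 (Cdiff_iff _ _ _) Hf e1 He1) as [d1 [Hd1 K1]].
  set (e2 := Rmin 1 (eps / (2 * (Cmod l + 1)))).
  assert (He2 : 0 < e2).
  { apply Rmin_glb_lt; [lra|]. apply Rdiv_lt_0_compat; lra. }
  destruct (proj1 (curve_deriv_iff _ _ _) Hg e2 He2) as [d2 [Hd2 K2]].
  exists (Rmin d2 (d1 / (Cmod v + 1))). split.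
  { apply Rmin_glb_lt; [lra|]. apply Rdiv_lt_0_compat; lra. }
  intros h Hh.
  assert (L2 := K2 h (Rlt_le_trans _ _ _ Hh (Rmin_l _ _))).
  assert (L3 := Rlt_le_trans _ _ _ Hh (Rmin_r _ _)).
  assert (Hh0 := Rabs_pos h).
  set (k := (g (x + h)%R - g x)%C) in *.
  assert (M1 : e2 <= 1) by apply Rmin_l.
  assert (M2 : e2 * (2 * (Cmod l + 1)) <= eps).
  { replace eps with (eps / (2 * (Cmod l + 1)) * (2 * (Cmod l + 1))) by (field; lra).
    apply Rmult_le_compat_r; [lra|apply Rmin_r]. }
  assert (M3 : e1 * (2 * (Cmod v + 1)) = eps) by (unfold e1; field; lra).
  assert (M4 : Rabs h * (Cmod v + 1) < d1).
  { apply (Rmult_lt_compat_r (Cmod v + 1)) in L3; [|lra].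
    unfold Rdiv in L3. rewrite (Rmult_assoc d1), Rinv_l in L3; lra. }
  assert (Hk : Cmod k <= Rabs h * (Cmod v + 1)).
  { replace k with (k - h * v + h * v)%C by ring.
    eapply Rle_trans; [apply Cmod_triangle|].
    rewrite Cmod_mult, Cmod_R. nra. }
  specialize (K1 k ltac:(lra)).
  replace (g x + k)%C with (g (x + h)) in K1 by (unfold k; ring).
  replace (f (g (x + h)%R) - f (g x) - h * (l * v))%C
    with ((f (g (x + h)%R) - f (g x) - l * k) + l * (k - h * v))%C by ring.
  eapply Rle_trans; [apply Cmod_triangle|]. rewrite Cmod_mult.
  assert (N1 : e1 * Cmod k <= eps / 2 * Rabs h).
  { replace (eps / 2 * Rabs h) with (e1 * (Rabs h * (Cmod v + 1)))
      by (rewrite <- M3; field).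
    apply Rmult_le_compat_l; lra. }
  assert (N2 : Cmod l * Cmod (k - h * v)%C <= eps / 2 * Rabs h).
  { apply Rle_trans with (Cmod l * (e2 * Rabs h)).
    - apply Rmult_le_compat_l; lra.
    - rewrite <- Rmult_assoc. apply Rmult_le_compat_r; nra. }
  lra.
Qed.

Lemma curve_deriv_mult (g k : R -> C) (x : R) (u v : C) :
  curve_deriv g x u -> curve_deriv k x v ->
  curve_deriv (fun t => g t * k t)%C x (u * k x + g x * v)%C.
Proof.
  intros [G1 G2] [K1 K2].
  assert (M := fun a b a' b' (A : is_derive a x a') (B : is_derive b x b') =>
    is_derive_mult (K := R_AbsRing) a b x a' b' A B Rmult_comm).
  split.
  - apply (is_derive_ext (fun t => Re (g t) * Re (k t) - Im (g t) * Im (k t))).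
    { intros t. reflexivity. }
    replace (Re _) with (Re u * Re (k x) + Re (g x) * Re v
       - (Im u * Im (k x) + Im (g x) * Im v)) by (unfold Re, Im; simpl; ring).
    exact (is_derive_minus _ _ x _ _ (M _ _ _ _ G1 K1) (M _ _ _ _ G2 K2)).
  - apply (is_derive_ext (fun t => Re (g t) * Im (k t) + Im (g t) * Re (k t))).
    { intros t. reflexivity. }
    replace (Im _) with (Re u * Im (k x) + Re (g x) * Im v
       + (Im u * Re (k x) + Im (g x) * Re v)) by (unfold Re, Im; simpl; ring).
    exact (is_derive_plus _ _ x _ _ (M _ _ _ _ G1 K2) (M _ _ _ _ G2 K1)).
Qed.

Lemma curve_deriv_plus (g k : R -> C) (x : R) (u v : C) :
  curve_deriv g x u -> curve_deriv k x v ->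
  curve_deriv (fun t => g t + k t)%C x (u + v)%C.
Proof.
  intros [G1 G2] [K1 K2]. split.
  - apply (is_derive_plus (fun t => Re (g t)) (fun t => Re (k t))); assumption.
  - apply (is_derive_plus (fun t => Im (g t)) (fun t => Im (k t))); assumption.
Qed.

Lemma curve_deriv_eq (g : R -> C) (x : R) (u v : C) :
  curve_deriv g x u -> u = v -> curve_deriv g x v.
Proof. intros H <-; exact H. Qed.

Lemma Cdiff_div (f g : C -> C) (z l m : C) :
  Cdiff f z l -> Cdiff g z m -> g z <> 0%C ->
  Cdiff (fun w => f w / g w)%C z ((l * g z - f z * m) / (g z * g z))%C.
Proof.
  intros Hf Hg Hz. unfold Cdiff in *.
  assert (H := is_derive_comp (K := C_AbsRing) (V := AbsRing_NormedModule C_AbsRing)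
    Cinv g z _ _ (Cdiff_inv _ Hz) Hg).
  assert (H2 := is_derive_mult (K := C_AbsRing) f (fun w => / g w)%C z _ _ Hf H Cmult_comm).
  replace ((l * g z - f z * m) / (g z * g z))%C
    with (plus (mult l (/ g z)%C) (mult (f z) (scal m (- / (g z * g z))%C))).
  - exact H2.
  - change (@eq C (l * / g z + f z * (m * - / (g z * g z)))%C
      ((l * g z - f z * m) / (g z * g z))%C). field. exact Hz.
Qed.

(** For [F t = f (g t)], with [g1 = g'] and [kap = g'' / g'], these are [F'],
    [F'' / F'] and the Schwarzian of [F]; the last formula supposes that the
    Schwarzian of [g] vanishes. *)
Section Along_curve.

Variables (f : C -> C) (g g1 kap : R -> C).

Definition curve_velocity (t : R) : C := (C_derive f (g t) * g1 t)%C.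
Definition curve_pre_schwarzian (t : R) : C := (pre_schwarzian f (g t) * g1 t + kap t)%C.
Definition curve_schwarzian (t : R) : C := (schwarzian f (g t) * (g1 t * g1 t))%C.

(** Chain rule of the Schwarzian derivative along a curve of zero Schwarzian,
    which is the condition [kap' = kap^2 / 2]; it holds for the real parametrization
    of a circular arc by a Moebius map and for an affine parametrization
    ([kap = 0]). *)
Lemma schwarzian_along_curve (x : R) :
  analytic_on_disk f -> unit_disk (g x) -> C_derive f (g x) <> 0%C ->
  curve_deriv g x (g1 x) -> curve_deriv g1 x (kap x * g1 x)%C ->
  curve_deriv kap x (RtoC (1 / 2) * (kap x * kap x))%C ->
  curve_deriv (fun t => f (g t)) x (curve_velocity x) /\
  curve_deriv curve_velocity x (curve_pre_schwarzian x * curve_velocity x)%C /\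
  curve_deriv curve_pre_schwarzian x
    (RtoC (1 / 2) * (curve_pre_schwarzian x * curve_pre_schwarzian x)
     + curve_schwarzian x)%C.
Proof.
  intros Hf Hx Hn Hg Hg1 Hk.
  assert (Hf1 := analytic_C_derive f Hf).
  assert (Hf2 := analytic_C_derive _ Hf1).
  assert (D0 := analytic_Cdiff f Hf _ Hx).
  assert (D1 := analytic_Cdiff _ Hf1 _ Hx).
  assert (D2 := analytic_Cdiff _ Hf2 _ Hx).
  assert (D3 : Cdiff (pre_schwarzian f) (g x) (C_derive (pre_schwarzian f) (g x))).
  { assert (E := Cdiff_div _ _ _ _ _ D2 D1 Hn).
    assert (E' := Cdiff_unique (pre_schwarzian f) _ _ E). rewrite E'. exact E. }
  split; [|split].
  - exact (curve_deriv_comp f g x _ _ D0 Hg).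
  - refine (curve_deriv_eq _ _ _ _ (curve_deriv_mult _ _ _ _ _
      (curve_deriv_comp _ g x _ _ D1 Hg) Hg1) _).
    unfold curve_velocity, curve_pre_schwarzian, pre_schwarzian. field. exact Hn.
  - refine (curve_deriv_eq _ _ _ _ (curve_deriv_plus _ _ _ _ _ (curve_deriv_mult _ _ _ _ _
      (curve_deriv_comp _ g x _ _ D3 Hg) Hg1) Hk) _).
    unfold curve_schwarzian, curve_pre_schwarzian, schwarzian.
    replace (RtoC (1 / 2)) with (/ 2)%C by (rewrite <- RtoC_inv by lra; f_equal; field).
    field.
Qed.

End Along_curve.

(** * Comparison for linear equations with complex coefficient *)

Lemma is_derive_Cmod (V : R -> C) (x : R) (k : C) :
  curve_deriv V x (k * V x)%C -> V x <> 0%C ->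
  is_derive (fun t => Cmod (V t)) x (Re k * Cmod (V x)).
Proof.
  intros [H1 H2] H0.
  assert (P := proj1 (Cmod_gt_0 _) H0).
  assert (E : Cmod (V x) * Cmod (V x) = Re (V x) ^ 2 + Im (V x) ^ 2)
    by (rewrite <- Cmod2_alt; ring).
  assert (Q : 0 < Re (V x) * Re (V x) + Im (V x) * Im (V x)) by nra.
  apply (is_derive_ext (fun t => sqrt (Re (V t) * Re (V t) + Im (V t) * Im (V t)))).
  { intros t. unfold Cmod. f_equal. unfold Re, Im. simpl. ring. }
  assert (N : is_derive (fun t => Re (V t) * Re (V t) + Im (V t) * Im (V t)) x
     (Re (k * V x)%C * Re (V x) + Re (V x) * Re (k * V x)%C
      + (Im (k * V x)%C * Im (V x) + Im (V x) * Im (k * V x)%C))).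
  { apply (is_derive_plus (fun t => Re (V t) * Re (V t)) (fun t => Im (V t) * Im (V t))).
    - exact (is_derive_mult (K := R_AbsRing) _ _ x _ _ H1 H1 Rmult_comm).
    - exact (is_derive_mult (K := R_AbsRing) _ _ x _ _ H2 H2 Rmult_comm). }
  assert (M := is_derive_sqrt _ _ _ N Q). cbv beta in M.
  replace (sqrt (Re (V x) * Re (V x) + Im (V x) * Im (V x))) with (Cmod (V x)) in M
    by (unfold Cmod; f_equal; unfold Re, Im; simpl; ring).
  replace (Re k * Cmod (V x)) with ((Re (k * V x)%C * Re (V x) + Re (V x) * Re (k * V x)%C
      + (Im (k * V x)%C * Im (V x) + Im (V x) * Im (k * V x)%C)) / (2 * Cmod (V x)));
    [exact M|].
  apply (Rmult_eq_reg_r (2 * Cmod (V x))); [|lra].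
  unfold Rdiv. rewrite Rmult_assoc, Rinv_l, Rmult_1_r by lra.
  replace (Re k * Cmod (V x) * (2 * Cmod (V x)))
    with (2 * Re k * (Cmod (V x) * Cmod (V x))) by ring.
  rewrite E. unfold Re, Im. simpl. ring.
Qed.

(** The quotient rule with every ingredient an unknown real function: [X + iY] is
    the curve, [A + iB] its velocity, [D] the modulus of the velocity. *)
Lemma comparison_quotient_derive (X Y A B H D s : R -> R) (x dX dY dA dB dH dD ds : R) :
  is_derive X x dX -> is_derive Y x dY -> is_derive A x dA -> is_derive B x dB ->
  is_derive H x dH -> is_derive D x dD -> is_derive s x ds -> D x <> 0 ->
  is_derive (fun t => (X t * A t + Y t * B t - (H t / 2 + s t) * (X t ^ 2 + Y t ^ 2)) / D t) x
   ((dX * A x + X x * dA + dY * B x + Y x * dB - (dH / 2 + ds) * (X x ^ 2 + Y x ^ 2)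
     - (H x / 2 + s x) * (2 * X x * dX + 2 * Y x * dY)) / D x
    - (X x * A x + Y x * B x - (H x / 2 + s x) * (X x ^ 2 + Y x ^ 2)) * dD / D x ^ 2).
Proof.
  intros X' Y' A' B' H' D' s' H0.
  auto_derive.
  - repeat split; try (eexists; eassumption). exact H0.
  - rewrite (is_derive_unique (fun t : R => D t) _ _ D'),
     (is_derive_unique (fun t : R => X t) _ _ X'),
     (is_derive_unique (fun t : R => Y t) _ _ Y'),
     (is_derive_unique (fun t : R => A t) _ _ A'),
     (is_derive_unique (fun t : R => B t) _ _ B'),
     (is_derive_unique (fun t : R => H t) _ _ H'),
     (is_derive_unique (fun t : R => s t) _ _ s').
    field. exact H0.
Qed.

(** With [u = F / sqrt F'] the equations [F' = V], [V' = h V] and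
    [h' = h^2/2 + S] give [u'' + (S/2) u = 0]. The form below is
    [Re (conj u * u') - sigma |u|^2], written through [F], [V] and [h] so that no
    branch of the square root is chosen. *)
Section Comparison.

Variables (F V h S : R -> C) (sigma : R -> R).

Definition comparison_form (t : R) : R :=
  (Re (F t) * Re (V t) + Im (F t) * Im (V t)
   - (Re (h t) / 2 + sigma t) * (Re (F t) ^ 2 + Im (F t) ^ 2)) / Cmod (V t).

(** In terms of [u] this is
    [|u' - sigma u|^2 + (- sigma' - sigma^2 - Re (S/2)) |u|^2],
    a square plus the defect in the Riccati inequality for [sigma]. *)
Lemma comparison_form_derive (x ds : R) :
  curve_deriv F x (V x) -> curve_deriv V x (h x * V x)%C ->
  curve_deriv h x (RtoC (1 / 2) * (h x * h x) + S x)%C -> V x <> 0%C ->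
  is_derive sigma x ds ->
  is_derive comparison_form x
   ((Cmod (V x - (h x / 2 + sigma x) * F x)%C ^ 2
     + (- ds - sigma x ^ 2 - Re (S x) / 2) * Cmod (F x) ^ 2) / Cmod (V x)).
Proof.
  intros F' V' h' HV s'.
  assert (D' := is_derive_Cmod V x (h x) V' HV).
  assert (P := proj1 (Cmod_gt_0 _) HV).
  destruct F' as [X1 Y1], V' as [A1 B1], h' as [H1 K1].
  rewrite !Cmod2_alt.
  unfold comparison_form.
  evar_last.
  { apply (comparison_quotient_derive _ _ _ _ _ _ sigma x _ _ _ _ _ _ _
      X1 Y1 A1 B1 H1 D' s'). lra. }
  unfold Cdiv, Re, Im. simpl. field. lra.
Qed.

End Comparison.

Lemma nondecreasing_of_derive (g dg : R -> R) (a b : R) :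
  a <= b -> (forall x, a <= x <= b -> is_derive g x (dg x)) ->
  (forall x, a <= x <= b -> 0 <= dg x) -> g a <= g b.
Proof.
  intros Hab H H0.
  destruct (MVT_gen g a b dg) as [c [Hc E]]; rewrite ?Rmin_left, ?Rmax_right in * by lra.
  - intros x Hx. apply H. lra.
  - intros x Hx. apply derivable_continuous_pt.
    exists (dg x). apply is_derive_Reals, H, Hx.
  - specialize (H0 c Hc). nra.
Qed.

Lemma increase_of_derive_pos (g : R -> R) (a b l : R) :
  a < b -> is_derive g a l -> 0 < l -> exists x, a < x < b /\ g a < g x.
Proof.
  intros Hab H Hl.
  destruct (proj1 (is_derive_R_iff _ _ _) H (l / 2)) as [d [Hd K]]; [lra|].
  set (e := Rmin d (b - a) / 2).
  assert (He : 0 < e /\ e < d /\ e < b - a).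
  { assert (A1 := Rmin_l d (b - a)). assert (A2 := Rmin_r d (b - a)).
    assert (A3 : 0 < Rmin d (b - a)) by (apply Rmin_glb_lt; lra).
    unfold e; lra. }
  exists (a + e). split; [lra|].
  specialize (K e). rewrite (Rabs_pos_eq e) in K by lra.
  specialize (K (proj1 (proj2 He))).
  apply Rabs_le_between in K. nra.
Qed.

(** Sturm comparison for a complex coefficient. If [sigma] satisfies the Riccati
    inequality [sigma' + sigma^2 <= - |S| / 2], as the logarithmic derivative of a
    positive supersolution does, the comparison form is nondecreasing. It vanishes
    wherever [F] does, and at a zero of [F] its derivative is [|V| > 0]; so [F] cannot
    vanish again. *)
Lemma no_second_zero (F V h S : R -> C) (sigma dsigma : R -> R) (t : R) :
  0 < t ->
  (forall x, 0 <= x <= t -> V x <> 0%C /\ curve_deriv F x (V x) /\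
     curve_deriv V x (h x * V x)%C /\
     curve_deriv h x (RtoC (1 / 2) * (h x * h x) + S x)%C) ->
  (forall x, 0 <= x <= t -> is_derive sigma x (dsigma x) /\
     dsigma x + sigma x ^ 2 <= - (Cmod (S x) / 2)) ->
  F 0 = 0%C -> F t <> 0%C.
Proof.
  intros Ht HF Hs F0 Ft.
  set (G := comparison_form F V h sigma).
  set (dG := fun x => (Cmod (V x - (h x / 2 + sigma x) * F x)%C ^ 2
     + (- dsigma x - sigma x ^ 2 - Re (S x) / 2) * Cmod (F x) ^ 2) / Cmod (V x)).
  assert (D : forall x, 0 <= x <= t -> is_derive G x (dG x)).
  { intros x Hx. destruct (HF x Hx) as [H0 [H1 [H2 H3]]].
    apply (comparison_form_derive F V h S); auto. apply Hs, Hx. }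
  assert (P : forall x, 0 <= x <= t -> 0 <= dG x).
  { intros x Hx. destruct (HF x Hx) as [H0 _]. destruct (Hs x Hx) as [_ H1].
    assert (H2 := re_le_Cmod (S x)). assert (H3 := Rle_abs (Re (S x))).
    apply Rdiv_le_0_compat; [|apply Cmod_gt_0, H0].
    apply Rplus_le_le_0_compat; [apply pow2_ge_0|].
    apply Rmult_le_pos; [lra|apply pow2_ge_0]. }
  assert (G0 : G 0 = 0).
  { unfold G, comparison_form. rewrite F0. simpl. unfold Rdiv. ring. }
  assert (Gt : G t = 0).
  { unfold G, comparison_form. rewrite Ft. simpl. unfold Rdiv. ring. }
  assert (P0 : 0 < dG 0).
  { destruct (HF 0 ltac:(lra)) as [H0 _]. apply Cmod_gt_0 in H0.
    unfold dG. rewrite F0, Cmod_0.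
    replace (V 0 - (h 0 / 2 + sigma 0) * 0)%C with (V 0) by ring.
    apply Rdiv_lt_0_compat; [|exact H0]. nra. }
  destruct (increase_of_derive_pos G 0 t _ Ht (D 0 ltac:(lra)) P0) as [x [Hx Hgt]].
  assert (G x <= G t).
  { apply nondecreasing_of_derive with dG; [lra|..]; intros y Hy;
      [apply D|apply P]; lra. }
  lra.
Qed.

Lemma energy_quotient_derive (H K D : R -> R) (x dH dK dD : R) :
  is_derive H x dH -> is_derive K x dK -> is_derive D x dD -> D x <> 0 ->
  is_derive (fun t => (1 + (H t ^ 2 + K t ^ 2) / 4) / D t) x
   ((H x * dH + K x * dK) / 2 / D x - (1 + (H x ^ 2 + K x ^ 2) / 4) * dD / D x ^ 2).
Proof.
  intros H' K' D' H0. auto_derive.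
  - repeat split; try (eexists; eassumption). exact H0.
  - rewrite (is_derive_unique (fun t : R => D t) _ _ D'),
      (is_derive_unique (fun t : R => H t) _ _ H'),
      (is_derive_unique (fun t : R => K t) _ _ K').
    field. exact H0.
Qed.

(** The energy is [|u|^2 + |u'|^2] for [u = 1 / sqrt V], another solution of
    [u'' + (S/2) u = 0]. It can grow at most exponentially, so [V] stays away from 0
    as long as [S] is bounded. *)
Section Energy.
Variables (V h S : R -> C).

Definition ode_energy (t : R) : R :=
  (1 + (Re (h t) ^ 2 + Im (h t) ^ 2) / 4) / Cmod (V t).

Lemma ode_energy_derive (x : R) :
  curve_deriv V x (h x * V x)%C ->
  curve_deriv h x (RtoC (1 / 2) * (h x * h x) + S x)%C -> V x <> 0%C ->
  is_derive ode_energy x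
   ((- Re (h x) + (Re (h x) * Re (S x) + Im (h x) * Im (S x)) / 2) / Cmod (V x)).
Proof.
  intros V' [H1 K1] HV.
  assert (D' := is_derive_Cmod V x (h x) V' HV).
  assert (P := proj1 (Cmod_gt_0 _) HV).
  evar_last.
  { apply (energy_quotient_derive _ _ _ x _ _ _ H1 K1 D'). lra. }
  unfold Re, Im. simpl. field. lra.
Qed.

Lemma ode_energy_growth (B : R) (x : R) : V x <> 0%C -> Cmod (S x) <= B ->
  (- Re (h x) + (Re (h x) * Re (S x) + Im (h x) * Im (S x)) / 2) / Cmod (V x)
   <= (1 + B) * ode_energy x.
Proof.
  intros HV HB.
  assert (P := proj1 (Cmod_gt_0 _) HV).
  unfold ode_energy, Rdiv. rewrite <- Rmult_assoc.
  apply Rmult_le_compat_r; [left; apply Rinv_0_lt_compat, P|].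
  assert (E : Cmod (S x) ^ 2 = Re (S x) ^ 2 + Im (S x) ^ 2) by apply Cmod2_alt.
  assert (HS := Cmod_ge_0 (S x)).
  set (a := Re (h x)) in *. set (b := Im (h x)) in *.
  set (p := Re (S x)) in *. set (q := Im (S x)) in *. set (m := Cmod (S x)) in *.
  assert (C1 : a * p + b * q <= m * (2 + (a ^ 2 + b ^ 2) / 2)).
  { assert (a * p + b * q <= m * sqrt (a ^ 2 + b ^ 2)).
    { apply Rsqr_incr_0_var; [|apply Rmult_le_pos; [lra|apply sqrt_pos]].
      rewrite Rsqr_mult, Rsqr_sqrt by nra. unfold Rsqr.
      replace (m * m) with (p ^ 2 + q ^ 2) by lra.
      assert (0 <= (a * q - b * p) ^ 2) by apply pow2_ge_0. nra. }
    assert (R0 := sqrt_pos (a ^ 2 + b ^ 2)).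
    assert (R1 : sqrt (a ^ 2 + b ^ 2) * sqrt (a ^ 2 + b ^ 2) = a ^ 2 + b ^ 2)
      by (apply sqrt_sqrt; nra).
    (* r <= 1 + r^2 / 4 for r = |h x| *)
    assert (0 <= (sqrt (a ^ 2 + b ^ 2) - 2) ^ 2) by apply pow2_ge_0.
    apply Rle_trans with (1 := H). apply Rmult_le_compat_l; [lra|]. nra. }
  assert (C2 : - a <= 1 + (a ^ 2 + b ^ 2) / 4).
  { assert (0 <= (a + 2) ^ 2) by apply pow2_ge_0. nra. }
  assert (C3 : m * (1 + (a ^ 2 + b ^ 2) / 4) <= B * (1 + (a ^ 2 + b ^ 2) / 4)).
  { apply Rmult_le_compat_r; [nra|exact HB]. }
  lra.
Qed.

Lemma ode_energy_bound (B T : R) : 0 <= T ->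
  (forall x, 0 <= x <= T -> V x <> 0%C /\ Cmod (S x) <= B /\
     curve_deriv V x (h x * V x)%C /\
     curve_deriv h x (RtoC (1 / 2) * (h x * h x) + S x)%C) ->
  ode_energy T <= ode_energy 0 * exp ((1 + B) * T).
Proof.
  intros HT H.
  set (dE := fun x => (- Re (h x) + (Re (h x) * Re (S x) + Im (h x) * Im (S x)) / 2)
      / Cmod (V x)).
  assert (M : - (ode_energy 0 * exp (- ((1 + B) * 0)))
      <= - (ode_energy T * exp (- ((1 + B) * T)))).
  { apply (nondecreasing_of_derive (fun x => - (ode_energy x * exp (- ((1 + B) * x))))
      (fun x => ((1 + B) * ode_energy x - dE x) * exp (- ((1 + B) * x)))); [lra|..];
    intros x Hx; destruct (H x Hx) as [H0 [H1 [H2 H3]]].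
    - assert (D := ode_energy_derive x H2 H3 H0). fold (dE x) in D.
      set (g := ode_energy) in *. clearbody g.
      auto_derive; [exists (dE x); exact D|].
      rewrite (is_derive_unique (fun t : R => g t) _ _ D). ring.
    - apply Rmult_le_pos; [|left; apply exp_pos].
      assert (Q := ode_energy_growth B x H0 H1). fold (dE x) in Q. lra. }
  rewrite Rmult_0_r, Ropp_0, exp_0 in M.
  assert (X := exp_pos ((1 + B) * T)).
  replace (ode_energy T) with (ode_energy T * exp (- ((1 + B) * T)) * exp ((1 + B) * T)).
  - apply Rmult_le_compat_r; lra.
  - rewrite Rmult_assoc, <- exp_plus, Rplus_opp_l, exp_0. ring.
Qed.
End Energy.

(** * The derivative has no zeros *)

Lemma curve_deriv_affine (a b : C) (x : R) : curve_deriv (fun t => a + t * b)%C x b.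
Proof.
  apply curve_deriv_iff. intros eps Heps. exists 1. split; [lra|]. intros h _.
  replace (a + (x + h)%R * b - (a + x * b) - h * b)%C with (RtoC 0)
    by (rewrite RtoC_plus; ring).
  rewrite Cmod_0. apply Rmult_le_pos; [lra|apply Rabs_pos].
Qed.

Lemma curve_deriv_const (a : C) (x : R) : curve_deriv (fun _ => a) x 0%C.
Proof. split; apply (is_derive_const (V := R_NormedModule)). Qed.

Lemma Cmod_triangle_rev (z w : C) : Rabs (Cmod z - Cmod w) <= Cmod (z - w)%C.
Proof.
  assert (H1 := Cmod_triangle (z - w) w). assert (H2 := Cmod_triangle (w - z) z).
  replace (z - w + w)%C with z in H1 by ring.
  replace (w - z + z)%C with w in H2 by ring.
  replace (w - z)%C with (- (z - w))%C in H2 by ring. rewrite Cmod_opp in H2.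
  apply Rabs_le. lra.
Qed.

Lemma Cmod_curve_continuous (V : R -> C) (x : R) (v : C) : curve_deriv V x v ->
  forall eps, 0 < eps -> exists d, 0 < d /\ forall y, Rabs (y - x) < d ->
    Rabs (Cmod (V y) - Cmod (V x)) < eps.
Proof.
  intros H eps Heps.
  destruct (proj1 (curve_deriv_iff _ _ _) H 1 Rlt_0_1) as [d [Hd K]].
  assert (Hv := Cmod_ge_0 v).
  exists (Rmin d (eps / (Cmod v + 1))). split.
  { apply Rmin_glb_lt; [lra|]. apply Rdiv_lt_0_compat; lra. }
  intros y Hy.
  assert (L1 := Rlt_le_trans _ _ _ Hy (Rmin_l _ _)).
  assert (L2 := Rlt_le_trans _ _ _ Hy (Rmin_r _ _)).
  apply (Rmult_lt_compat_r (Cmod v + 1)) in L2; [|lra].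
  unfold Rdiv in L2. rewrite (Rmult_assoc eps), Rinv_l in L2 by lra.
  specialize (K (y - x) L1). replace (x + (y - x)) with y in K by ring.
  eapply Rle_lt_trans; [apply Cmod_triangle_rev|].
  replace (V y - V x)%C with (V y - V x - (y - x)%R * v + (y - x)%R * v)%C by ring.
  eapply Rle_lt_trans; [apply Cmod_triangle|]. rewrite Cmod_mult, Cmod_R. lra.
Qed.

(** Continuation argument: as long as [phi] has no zero it stays above [m], and then
    by continuity it has no zero slightly further on. *)
Lemma nonzero_by_continuation (phi : R -> R) (m : R) :
  (forall x, 0 <= x <= 1 -> forall eps, 0 < eps -> exists d, 0 < d /\
     forall y, Rabs (y - x) < d -> Rabs (phi y - phi x) < eps) ->
  0 < m -> phi 0 <> 0 ->
  (forall T, 0 <= T <= 1 -> (forall s, 0 <= s <= T -> phi s <> 0) -> m <= phi T) ->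
  phi 1 <> 0.
Proof.
  intros Hc Hm H0 Hstep.
  set (E := fun t => 0 <= t <= 1 /\ forall s, 0 <= s <= t -> phi s <> 0).
  assert (E0 : E 0).
  { split; [lra|]. intros s Hs. replace s with 0 by lra. exact H0. }
  destruct (completeness E) as [T [HT1 HT2]].
  { exists 1. intros t Ht. apply Ht. }
  { exists 0. exact E0. }
  assert (T0 : 0 <= T <= 1).
  { split; [apply HT1, E0|apply HT2; intros t Ht; apply Ht]. }
  assert (below : forall s, 0 <= s < T -> E s).
  { intros s Hs. apply NNPP. intros N.
    assert (T <= s); [|lra]. apply HT2. intros t Ht.
    destruct (Rle_lt_dec t s) as [|Hlt]; [assumption|]. exfalso. apply N.
    split; [lra|]. intros u Hu. apply Ht. lra. }
  assert (near : forall eps, 0 < eps -> exists d, 0 < d /\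
     forall y, Rabs (y - T) < d -> Rabs (phi y - phi T) < eps) by (apply Hc, T0).
  assert (phiT : m / 2 <= phi T).
  { destruct (Req_dec T 0) as [->|Tn].
    - assert (m <= phi 0); [|lra]. apply Hstep; [lra|]. apply E0.
    - destruct (near (m / 2)) as [d [Hd K]]; [lra|].
      set (s := Rmax 0 (T - d / 2)).
      assert (0 <= s < T /\ T - d / 2 <= s).
      { split; [split; [apply Rmax_l|apply Rmax_lub_lt; lra]|apply Rmax_r]. }
      assert (Es := below s ltac:(lra)).
      assert (m <= phi s) by (apply Hstep; apply Es).
      specialize (K s). rewrite Rabs_left1 in K by lra.
      specialize (K ltac:(lra)). apply Rabs_def2 in K. lra. }
  assert (ET : E T).
  { split; [exact T0|]. intros s Hs. destruct (Req_dec s T) as [->|N]; [lra|].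
    apply (below s); lra. }
  destruct (Req_dec T 1) as [->|N]; [lra|].
  destruct (near (m / 2)) as [d [Hd K]]; [lra|].
  set (t := Rmin 1 (T + d / 2)).
  assert (Ht : T < t /\ t <= 1 /\ t <= T + d / 2).
  { split; [apply Rmin_glb_lt; lra|]. split; [apply Rmin_l|apply Rmin_r]. }
  assert (Et : E t).
  { split; [lra|]. intros s Hs. destruct (Rle_lt_dec s T); [apply ET; lra|].
    specialize (K s). rewrite Rabs_pos_eq in K by lra.
    specialize (K ltac:(lra)). apply Rabs_def2 in K. lra. }
  apply HT1 in Et. lra.
Qed.

Lemma derivative_not_identically_zero (f : C -> C) :
  analytic_on_disk f -> locally_univalent_on_disk f ->
  exists z, unit_disk z /\ C_derive f z <> 0%C.
Proof.
  intros Hf Hu. apply NNPP. intros N.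
  assert (U0 : unit_disk 0%C) by (unfold unit_disk; rewrite Cmod_0; lra).
  destruct (Hu 0%C U0) as [r [Hr Hi]].
  set (b := Rmin 1 r / 2).
  assert (Hb : 0 < b /\ b < 1 /\ b < r).
  { assert (A1 := Rmin_l 1 r). assert (A2 := Rmin_r 1 r).
    assert (0 < Rmin 1 r) by (apply Rmin_glb_lt; lra). unfold b; lra. }
  assert (HM : forall x, Rabs x < 1 -> unit_disk (0 + x * 1)%C).
  { intros x Hx. unfold unit_disk. replace (0 + x * 1)%C with (RtoC x) by ring.
    rewrite Cmod_R. exact Hx. }
  assert (D : forall x, 0 <= x <= b -> curve_deriv (fun t => f (0 + t * 1)%C) x 0%C).
  { intros x Hx. assert (Ux : unit_disk (0 + x * 1)%C).
    { apply HM. rewrite Rabs_pos_eq; lra. }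
    assert (Z : C_derive f (0 + x * 1)%C = 0%C).
    { apply NNPP. intros Z. apply N. exists (0 + x * 1)%C. auto. }
    refine (curve_deriv_eq _ _ _ _ (curve_deriv_comp f (fun t => 0 + t * 1)%C x _ _
      (analytic_Cdiff f Hf _ Ux) (curve_deriv_affine 0 1 x)) _).
    rewrite Z. ring. }
  assert (const : forall g : R -> R, (forall x, 0 <= x <= b -> is_derive g x 0) -> g b = g 0).
  { intros g Hg. apply Rle_antisym.
    - apply Ropp_le_cancel. apply (nondecreasing_of_derive (fun x => - g x) (fun _ => 0));
        [lra| |intros; lra].
      intros x Hx. replace 0 with (opp 0) by (unfold opp; simpl; lra).
      apply (is_derive_opp g). auto.
    - apply (nondecreasing_of_derive g (fun _ => 0)); auto; intros; lra. }
  assert (Eq : f (0 + b * 1)%C = f (0 + 0 * 1)%C).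
  { apply injective_projections.
    - apply (const (fun t => Re (f (0 + t * 1)%C))). intros x Hx. apply D, Hx.
    - apply (const (fun t => Im (f (0 + t * 1)%C))). intros x Hx. apply D, Hx. }
  apply Hi in Eq.
  - replace (0 + b * 1)%C with (RtoC b) in Eq by ring.
    replace (0 + 0 * 1)%C with (RtoC 0) in Eq by ring. apply RtoC_inj in Eq. lra.
  - apply HM. rewrite Rabs_pos_eq; lra.
  - replace (0 + 0 * 1)%C with (RtoC 0) by ring. exact U0.
  - replace (0 + b * 1 - 0)%C with (RtoC b) by ring. rewrite Cmod_R, Rabs_pos_eq; lra.
  - replace (0 + 0 * 1 - 0)%C with (RtoC 0) by ring. rewrite Cmod_0; lra.
Qed.

(** The hyperbolic sup norm of the Schwarzian derivative. *)
Definition schwarzian_norm_le (f : C -> C) (M : R) : Prop :=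
  forall z, unit_disk z -> Cmod (schwarzian f z) * (1 - Cmod z ^ 2) ^ 2 <= M.

(** A zero of [f'] would be a double pole of the Schwarzian derivative, while the norm
    bound makes it bounded on compact sets. Concretely: follow the segment from a point
    where [f'] does not vanish to the supposed zero; the energy bound keeps [f'] away
    from 0 up to the end of the segment. *)
Lemma derivative_nonzero (f : C -> C) (M : R) :
  analytic_on_disk f -> locally_univalent_on_disk f -> schwarzian_norm_le f M ->
  forall z, unit_disk z -> C_derive f z <> 0%C.
Proof.
  intros Hf Hu HM z0 Hz0 Z.
  destruct (derivative_not_identically_zero f Hf Hu) as [z1 [Hz1 N1]].
  set (v := (z0 - z1)%C).
  set (g := fun t : R => (z1 + t * v)%C).
  set (V := curve_velocity f g (fun _ => v)).
  set (h := curve_pre_schwarzian f g (fun _ => v) (fun _ => 0%C)).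
  set (S := curve_schwarzian f g (fun _ => v)).
  assert (v0 : v <> 0%C).
  { intros v0. apply N1. replace z1 with z0; [exact Z|].
    replace z0 with (v + z1)%C by (unfold v; ring). rewrite v0. ring. }
  set (r := Rmax (Cmod z0) (Cmod z1)).
  assert (Hr : 0 <= r < 1).
  { split; [eapply Rle_trans; [apply (Cmod_ge_0 z0)|apply Rmax_l]|].
    apply Rmax_lub_lt; assumption. }
  assert (gr : forall t, 0 <= t <= 1 -> Cmod (g t) <= r).
  { intros t Ht. unfold g, v.
    replace (z1 + t * (z0 - z1))%C with ((1 - t)%R * z1 + t * z0)%C
      by (rewrite RtoC_minus; ring).
    eapply Rle_trans; [apply Cmod_triangle|].
    rewrite !Cmod_mult, !Cmod_R, !Rabs_pos_eq by lra.
    assert (A1 := Rmax_l (Cmod z0) (Cmod z1)). assert (A2 := Rmax_r (Cmod z0) (Cmod z1)).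
    fold r in A1, A2. nra. }
  assert (gu : forall t, 0 <= t <= 1 -> unit_disk (g t)).
  { intros t Ht. unfold unit_disk. specialize (gr t Ht). lra. }
  assert (V' : forall x, 0 <= x <= 1 -> exists l, curve_deriv V x l).
  { intros x Hx. eexists. apply curve_deriv_mult; [|apply curve_deriv_const].
    apply (curve_deriv_comp (C_derive f) g).
    - apply (analytic_Cdiff _ (analytic_C_derive f Hf)), gu, Hx.
    - apply curve_deriv_affine. }
  set (q := (1 - r ^ 2) ^ 2).
  assert (Hq : 0 < q) by (unfold q; apply pow_lt; nra).
  set (B := Rabs M / q * (Cmod v * Cmod v)).
  assert (HB0 : 0 <= B).
  { unfold B. assert (A := Cmod_ge_0 v). apply Rmult_le_pos; [|nra].
    apply Rdiv_le_0_compat; [apply Rabs_pos|exact Hq]. }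
  assert (HB : forall x, 0 <= x <= 1 -> Cmod (S x) <= B).
  { intros x Hx. unfold S, curve_schwarzian, B. rewrite !Cmod_mult.
    assert (A := Cmod_ge_0 v). apply Rmult_le_compat_r; [nra|].
    apply (Rmult_le_reg_r q); [exact Hq|].
    unfold Rdiv. rewrite Rmult_assoc, Rinv_l, Rmult_1_r by lra.
    apply Rle_trans with M; [|apply Rle_abs].
    eapply Rle_trans; [|apply (HM (g x)), gu, Hx].
    apply Rmult_le_compat_l; [apply Cmod_ge_0|].
    assert (A1 := gr x Hx). assert (A2 := Cmod_ge_0 (g x)).
    unfold q. apply pow_incr. split; [nra|].
    assert (Cmod (g x) ^ 2 <= r ^ 2) by (apply pow_incr; lra). lra. }
  assert (nz : forall x, C_derive f (g x) <> 0%C <-> V x <> 0%C).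
  { intros x. unfold V, curve_velocity. split; intros A.
    - apply Cmult_neq_0; assumption.
    - intros E. apply A. rewrite E. ring. }
  assert (g0 : g 0 = z1) by (unfold g; ring).
  assert (V0 : V 0 <> 0%C) by (apply nz; rewrite g0; exact N1).
  assert (E0 : 0 < ode_energy V h 0).
  { unfold ode_energy. apply Rdiv_lt_0_compat; [nra|]. apply Cmod_gt_0, V0. }
  assert (X := exp_pos (1 + B)).
  apply (nonzero_by_continuation (fun t => Cmod (V t))
    (/ (ode_energy V h 0 * exp (1 + B)))).
  - intros x Hx. destruct (V' x Hx) as [l Hl]. exact (Cmod_curve_continuous V x l Hl).
  - apply Rinv_0_lt_compat, Rmult_lt_0_compat; assumption.
  - intros E. apply V0, Cmod_eq_0, E.
  - intros T HT HV.
    assert (HV' : forall s, 0 <= s <= T -> V s <> 0%C).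
    { intros s Hs E. apply (HV s Hs). rewrite E. apply Cmod_0. }
    assert (P := proj1 (Cmod_gt_0 _) (HV' T ltac:(lra))).
    assert (Bd : ode_energy V h T <= ode_energy V h 0 * exp ((1 + B) * T)).
    { apply (ode_energy_bound V h S B T); [lra|]. intros x Hx.
      split; [auto|]. split; [apply HB; lra|].
      destruct (schwarzian_along_curve f g (fun _ => v) (fun _ => 0%C) x) as [_ R2]; auto.
      - apply gu; lra.
      - apply nz; auto.
      - apply curve_deriv_affine.
      - refine (curve_deriv_eq _ _ _ _ (curve_deriv_const v x) _). ring.
      - refine (curve_deriv_eq _ _ _ _ (curve_deriv_const 0 x) _). ring. }
    assert (L : / Cmod (V T) <= ode_energy V h T).
    { unfold ode_energy, Rdiv. rewrite <- (Rmult_1_l (/ Cmod (V T))) at 1.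
      apply Rmult_le_compat_r; [left; apply Rinv_0_lt_compat, P|]. nra. }
    assert (X2 : exp ((1 + B) * T) <= exp (1 + B)).
    { destruct (Req_dec ((1 + B) * T) (1 + B)) as [->|]; [lra|].
      left. apply exp_increasing. nra. }
    rewrite <- (Rinv_inv (Cmod (V T))).
    apply Rinv_le_contravar; [apply Rinv_0_lt_compat, P|].
    apply Rle_trans with (1 := L). apply Rle_trans with (1 := Bd).
    apply Rmult_le_compat_l; lra.
  - unfold V, curve_velocity. replace (g 1) with z0 by (unfold g, v; ring).
    rewrite Z. replace (0 * v)%C with (RtoC 0) by ring. apply Cmod_0.
Qed.

(** * Hyperbolic geodesics *)

(** The hyperbolic geodesic leaving [a] in the direction [lam] is the image of
    (-1,1) under the disk automorphism z |-> (a + lam z) / (1 + conj a lam z). For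
    x >= 0 the parameter [x] is the pseudo-hyperbolic distance from [a]; [geodesic_kappa] is
    [g'' / g'] for [g = geodesic]. *)
Section Geodesic.

Variables (a lam : C).
Hypotheses (Ha : unit_disk a) (Hlam : Cmod lam = 1).

Definition geo_denominator (x : R) : C := (1 + x * (Cconj a * lam))%C.
Definition geodesic (x : R) : C := ((a + x * lam) * / geo_denominator x)%C.
Definition geodesic_velocity (x : R) : C :=
  (lam * (1 - a * Cconj a) * (/ geo_denominator x * / geo_denominator x))%C.
Definition geodesic_kappa (x : R) : C :=
  (- RtoC 2 * (Cconj a * lam) * / geo_denominator x)%C.

Lemma Cmod_alpha : Cmod (Cconj a * lam)%C = Cmod a.
Proof. rewrite Cmod_mult, Hlam, Cmod_conj. ring. Qed.

Lemma geo_denominator_neq_0 (x : R) : Rabs x < 1 -> geo_denominator x <> 0%C.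
Proof.
  intros Hx E.
  assert (H : Cmod (x * (Cconj a * lam))%C = 1).
  { replace (x * (Cconj a * lam))%C with (geo_denominator x - 1)%C
      by (unfold geo_denominator; ring).
    rewrite E. replace (0 - 1)%C with (- (1))%C by ring. apply Cmod_m1. }
  rewrite Cmod_mult, Cmod_alpha, Cmod_R in H.
  unfold unit_disk in Ha. assert (A := Rabs_pos x). assert (A2 := Cmod_ge_0 a). nra.
Qed.

Lemma inv_denominator_derive (x : R) : Rabs x < 1 ->
  curve_deriv (fun t => / geo_denominator t)%C x
    (- / (geo_denominator x * geo_denominator x) * (Cconj a * lam))%C.
Proof.
  intros Hx. apply (curve_deriv_comp Cinv geo_denominator).
  - apply Cdiff_inv, geo_denominator_neq_0, Hx.
  - apply curve_deriv_affine.
Qed.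

Lemma geodesic_derive (x : R) : Rabs x < 1 ->
  curve_deriv geodesic x (geodesic_velocity x).
Proof.
  intros Hx. refine (curve_deriv_eq _ _ _ _ (curve_deriv_mult _ _ _ _ _
    (curve_deriv_affine a lam x) (inv_denominator_derive x Hx)) _).
  assert (H := geo_denominator_neq_0 x Hx).
  unfold geodesic_velocity.
  transitivity ((lam * geo_denominator x - (a + x * lam) * (Cconj a * lam))
    * (/ geo_denominator x * / geo_denominator x))%C.
  - field. exact H.
  - unfold geo_denominator. f_equal. ring.
Qed.

Lemma geodesic_velocity_derive (x : R) : Rabs x < 1 ->
  curve_deriv geodesic_velocity x (geodesic_kappa x * geodesic_velocity x)%C.
Proof.
  intros Hx. assert (I := inv_denominator_derive x Hx).
  refine (curve_deriv_eq _ _ _ _ (curve_deriv_mult _ _ _ _ _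
    (curve_deriv_const _ x) (curve_deriv_mult _ _ _ _ _ I I)) _).
  unfold geodesic_velocity, geodesic_kappa. field. apply geo_denominator_neq_0, Hx.
Qed.

(** A Moebius map has zero Schwarzian derivative. *)
Lemma geodesic_kappa_derive (x : R) : Rabs x < 1 ->
  curve_deriv geodesic_kappa x (RtoC (1 / 2) * (geodesic_kappa x * geodesic_kappa x))%C.
Proof.
  intros Hx. assert (I := inv_denominator_derive x Hx).
  refine (curve_deriv_eq _ _ _ _ (curve_deriv_mult _ _ _ _ _
    (curve_deriv_const _ x) I) _).
  unfold geodesic_kappa.
  replace (RtoC (1 / 2)) with (/ 2)%C by (rewrite <- RtoC_inv by lra; f_equal; field).
  field. apply geo_denominator_neq_0, Hx.
Qed.

Lemma denominator_sub_numerator (x : R) :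
  Cmod (geo_denominator x) ^ 2 - Cmod (a + x * lam)%C ^ 2
   = (1 - Cmod a ^ 2) * (1 - x ^ 2).
Proof.
  assert (L : Re lam ^ 2 + Im lam ^ 2 = 1) by (rewrite <- Cmod2_alt, Hlam; ring).
  rewrite !Cmod2_alt. unfold geo_denominator, Re, Im in *. simpl.
  destruct a as [a1 a2], lam as [l1 l2]. simpl in *. nra.
Qed.

(** Disk automorphisms are isometries of the hyperbolic metric; this turns a bound on
    (1-|z|^2)^2 |Sf(z)| into the same bound for the Schwarzian along the geodesic, with
    weight (1-x^2)^2. *)
Lemma geodesic_hyperbolic (x : R) : Rabs x < 1 ->
  1 - Cmod (geodesic x) ^ 2 = Cmod (geodesic_velocity x) * (1 - x ^ 2).
Proof.
  intros Hx. assert (H := geo_denominator_neq_0 x Hx).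
  assert (P := proj1 (Cmod_gt_0 _) H).
  assert (E := denominator_sub_numerator x).
  assert (V : Cmod (1 - a * Cconj a)%C = 1 - Cmod a ^ 2).
  { rewrite <- Cmod2_conj, <- RtoC_minus, Cmod_R, Rabs_pos_eq; [reflexivity|].
    unfold unit_disk in Ha. assert (A2 := Cmod_ge_0 a). nra. }
  unfold geodesic, geodesic_velocity.
  rewrite !Cmod_mult, Hlam, V, !Cmod_inv by exact H.
  apply (Rmult_eq_reg_r (Cmod (geo_denominator x) ^ 2)); [|nra].
  transitivity (Cmod (geo_denominator x) ^ 2 - Cmod (a + x * lam)%C ^ 2); [field; lra|].
  rewrite E. field. lra.
Qed.

Lemma geodesic_velocity_pos (x : R) : Rabs x < 1 -> 0 < Cmod (geodesic_velocity x).
Proof.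
  intros Hx. assert (H := geo_denominator_neq_0 x Hx).
  apply Cmod_gt_0. unfold geodesic_velocity.
  assert (lam <> 0%C) by (apply Cmod_gt_0; lra).
  assert (/ geo_denominator x <> 0)%C.
  { apply Cmod_gt_0. rewrite Cmod_inv by exact H. apply Rinv_0_lt_compat, Cmod_gt_0, H. }
  repeat apply Cmult_neq_0; auto.
  rewrite <- Cmod2_conj, <- RtoC_minus. intros E. apply RtoC_inj in E.
  unfold unit_disk in Ha. assert (A2 := Cmod_ge_0 a). nra.
Qed.

Lemma geodesic_in_disk (x : R) : Rabs x < 1 -> unit_disk (geodesic x).
Proof.
  intros Hx. assert (E := geodesic_hyperbolic x Hx).
  assert (P := geodesic_velocity_pos x Hx).
  assert (0 < 1 - x ^ 2) by (apply Rabs_def2 in Hx; nra).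
  unfold unit_disk. assert (A := Cmod_ge_0 (geodesic x)). nra.
Qed.

Lemma geodesic_0 : geodesic 0 = a.
Proof.
  unfold geodesic, geo_denominator.
  replace (1 + 0 * (Cconj a * lam))%C with (RtoC 1) by ring. field.
Qed.

(** A geodesic of the disk is a segment or a circular arc shorter than a semicircle, so the
    Euclidean distance to its initial point increases along it. *)
Lemma geodesic_dist_start (x t : R) : 0 <= x <= t -> t < 1 ->
  Cmod (geodesic x - a)%C <= Cmod (geodesic t - a)%C.
Proof.
  intros Hx Ht.
  assert (F : forall y, 0 <= y < 1 -> Cmod (geodesic y - a)%C
     = Cmod (1 - a * Cconj a)%C * (y / Cmod (geo_denominator y))).
  { intros y Hy. assert (H : geo_denominator y <> 0%C)
      by (apply geo_denominator_neq_0; rewrite Rabs_pos_eq; lra).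
    replace (geodesic y - a)%C
      with ((1 - a * Cconj a) * (y * lam * / geo_denominator y))%C.
    - rewrite !Cmod_mult, Cmod_inv, Cmod_R, Hlam, Rabs_pos_eq by (auto; lra).
      unfold Rdiv. ring.
    - unfold geodesic.
      transitivity ((a + y * lam - a * geo_denominator y) * / geo_denominator y)%C.
      + unfold geo_denominator at 2. ring.
      + field. exact H. }
  rewrite !F by lra.
  apply Rmult_le_compat_l; [apply Cmod_ge_0|].
  assert (Px : 0 < Cmod (geo_denominator x)).
  { apply Cmod_gt_0, geo_denominator_neq_0. rewrite Rabs_pos_eq; lra. }
  assert (Pt : 0 < Cmod (geo_denominator t)).
  { apply Cmod_gt_0, geo_denominator_neq_0. rewrite Rabs_pos_eq; lra. }
  apply (Rmult_le_reg_r (Cmod (geo_denominator x) * Cmod (geo_denominator t))); [nra|].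
  replace (x / Cmod (geo_denominator x) * (Cmod (geo_denominator x) * Cmod (geo_denominator t)))
    with (x * Cmod (geo_denominator t)) by (field; lra).
  replace (t / Cmod (geo_denominator t) * (Cmod (geo_denominator x) * Cmod (geo_denominator t)))
    with (t * Cmod (geo_denominator x)) by (field; lra).
  (* The difference of the squares is (t-x)(t+x+2xtp), p = Re (conj a lam). *)
  apply Rsqr_incr_0_var; [|nra]. rewrite !Rsqr_mult, !Rsqr_pow2, !Cmod2_alt.
  unfold geo_denominator. remember (Cconj a * lam)%C as al eqn:Eal.
  assert (L : Rabs (Re al) <= 1).
  { eapply Rle_trans; [apply re_le_Cmod|]. rewrite Eal, Cmod_alpha.
    unfold unit_disk in Ha. lra. }
  apply Rabs_le_between in L.
  unfold Re, Im in *. simpl.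
  clear Eal F Px Pt. destruct al as [p q]. simpl in *.
  assert (0 <= (t - x) * (t + x + 2 * (x * t) * p)).
  { apply Rmult_le_pos; [lra|]. assert (0 <= x * t) by nra.
    assert (x * t <= x) by nra. assert (x * t <= t) by nra. nra. }
  nra.
Qed.

End Geodesic.

Lemma one_sub_conj_neq_0 (a b : C) : unit_disk a -> unit_disk b ->
  (1 - Cconj a * b)%C <> 0%C.
Proof.
  intros Ha Hb E. unfold unit_disk in *.
  assert (H : Cmod (Cconj a * b)%C = 1).
  { replace (Cconj a * b)%C with (1 - (1 - Cconj a * b))%C by ring.
    rewrite E. replace (1 - 0)%C with (RtoC 1) by ring. apply Cmod_1. }
  rewrite Cmod_mult, Cmod_conj in H.
  assert (A := Cmod_ge_0 a). assert (A2 := Cmod_ge_0 b). nra.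
Qed.

Lemma pseudo_hyperbolic_bounds (a b : C) : unit_disk a -> unit_disk b -> a <> b ->
  0 < pseudo_hyperbolic a b < 1.
Proof.
  intros Ha Hb Hab. assert (N := one_sub_conj_neq_0 a b Ha Hb).
  unfold pseudo_hyperbolic. rewrite Cmod_div by exact N.
  assert (P := proj1 (Cmod_gt_0 _) N).
  assert (Q : 0 < Cmod (a - b)%C).
  { apply Cmod_gt_0. intros E. apply Hab. replace a with (a - b + b)%C by ring.
    rewrite E. ring. }
  split; [apply Rdiv_lt_0_compat; assumption|].
  apply (Rmult_lt_reg_r (Cmod (1 - Cconj a * b)%C)); [exact P|].
  unfold Rdiv. rewrite Rmult_assoc, Rinv_l, Rmult_1_r, Rmult_1_l by lra.
  assert (E : Cmod (1 - Cconj a * b)%C ^ 2 - Cmod (a - b)%C ^ 2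
     = (1 - Cmod a ^ 2) * (1 - Cmod b ^ 2)).
  { rewrite !Cmod2_alt. unfold Re, Im. destruct a, b; simpl. ring. }
  unfold unit_disk in *. assert (A := Cmod_ge_0 a). assert (A2 := Cmod_ge_0 b).
  assert (0 < (1 - Cmod a ^ 2) * (1 - Cmod b ^ 2)) by (apply Rmult_lt_0_compat; nra).
  nra.
Qed.

Definition geo_direction (a b : C) : C :=
  ((b - a) / (1 - Cconj a * b) / RtoC (pseudo_hyperbolic a b))%C.

Lemma Cmod_geo_direction (a b : C) : unit_disk a -> unit_disk b -> a <> b ->
  Cmod (geo_direction a b) = 1.
Proof.
  intros Ha Hb Hab. assert (N := one_sub_conj_neq_0 a b Ha Hb).
  assert (P := pseudo_hyperbolic_bounds a b Ha Hb Hab).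
  unfold geo_direction.
  assert (Nz : RtoC (pseudo_hyperbolic a b) <> 0%C).
  { intros E. apply RtoC_inj in E. lra. }
  rewrite Cmod_div, Cmod_R, Rabs_pos_eq by (auto; lra).
  replace ((b - a) / (1 - Cconj a * b))%C with (- ((a - b) / (1 - Cconj a * b)))%C
    by (field; exact N).
  rewrite Cmod_opp. fold (pseudo_hyperbolic a b). field. lra.
Qed.

Lemma geodesic_end (a b : C) : unit_disk a -> unit_disk b -> a <> b ->
  geodesic a (geo_direction a b) (pseudo_hyperbolic a b) = b.
Proof.
  intros Ha Hb Hab. assert (N := one_sub_conj_neq_0 a b Ha Hb).
  assert (N2 := one_sub_conj_neq_0 a a Ha Ha).
  assert (P := pseudo_hyperbolic_bounds a b Ha Hb Hab).
  assert (E : (RtoC (pseudo_hyperbolic a b) * geo_direction a b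
     = (b - a) / (1 - Cconj a * b))%C).
  { unfold geo_direction. field. split; [exact N|].
    intros E. apply RtoC_inj in E. lra. }
  unfold geodesic, geo_denominator.
  replace (pseudo_hyperbolic a b * (Cconj a * geo_direction a b))%C
    with (Cconj a * (RtoC (pseudo_hyperbolic a b) * geo_direction a b))%C by ring.
  rewrite E. field.
  assert (Q : (1 - Cconj a * b + Cconj a * (b - a))%C = (1 - Cconj a * a)%C) by ring.
  repeat split; auto; rewrite ?Q; auto.
Qed.

(** If [f] takes the same value at [a] and [b], then [f - f a] along the geodesic from
    [a] to [b] has two zeros, which the Sturm comparison excludes as soon as the
    Riccati inequality can be solved for the bound [K] valid on that geodesic. *)
Lemma geodesic_comparison (f : C -> C) (a b : C) (K : R) (sigma dsigma : R -> R) :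
  analytic_on_disk f -> (forall z, unit_disk z -> C_derive f z <> 0%C) ->
  unit_disk a -> unit_disk b -> a <> b -> f a = f b ->
  (forall x, 0 <= x <= pseudo_hyperbolic a b ->
     let z := geodesic a (geo_direction a b) x in
     Cmod (schwarzian f z) * (1 - Cmod z ^ 2) ^ 2 <= K) ->
  (forall x, 0 <= x <= pseudo_hyperbolic a b -> is_derive sigma x (dsigma x) /\
     (dsigma x + sigma x ^ 2) * (1 - x ^ 2) ^ 2 <= - (K / 2)) ->
  False.
Proof.
  intros Hf Hd Ha Hb Hab Hfab HS Hsig.
  assert (P := pseudo_hyperbolic_bounds a b Ha Hb Hab).
  assert (L := Cmod_geo_direction a b Ha Hb Hab).
  set (lam := geo_direction a b) in *. set (t := pseudo_hyperbolic a b) in *.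
  set (g := geodesic a lam) in *. set (g1 := geodesic_velocity a lam).
  apply (no_second_zero (fun x => f (g x) + - f a)%C (curve_velocity f g g1)
    (curve_pre_schwarzian f g g1 (geodesic_kappa a lam)) (curve_schwarzian f g g1)
    sigma dsigma t).
  - lra.
  - intros x Hx. assert (Hx1 : Rabs x < 1) by (rewrite Rabs_pos_eq; lra).
    assert (U : unit_disk (g x)) by (apply geodesic_in_disk; auto).
    destruct (schwarzian_along_curve f g g1 (geodesic_kappa a lam) x) as [R1 [R2 R3]]; auto.
    + apply geodesic_derive; auto.
    + apply geodesic_velocity_derive; auto.
    + apply geodesic_kappa_derive; auto.
    + split; [|split; [|split; assumption]].
      * apply Cmult_neq_0; [auto|]. apply Cmod_gt_0, geodesic_velocity_pos; auto.
      * refine (curve_deriv_eq _ _ _ _ (curve_deriv_plus _ _ _ _ _ R1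
          (curve_deriv_const (- f a)%C x)) _). ring.
  - intros x Hx. destruct (Hsig x Hx) as [D I]. split; [exact D|].
    assert (Hx1 : Rabs x < 1) by (rewrite Rabs_pos_eq; lra).
    assert (E := geodesic_hyperbolic a lam Ha L x Hx1). fold g g1 in E.
    specialize (HS x Hx). cbv zeta in HS. fold g in HS. rewrite E in HS.
    unfold curve_schwarzian. rewrite !Cmod_mult.
    apply (Rmult_le_reg_r ((1 - x ^ 2) ^ 2)); [apply pow_lt; nra|].
    replace (- (Cmod (schwarzian f (g x)) * (Cmod (g1 x) * Cmod (g1 x)) / 2) * (1 - x ^ 2) ^ 2)
      with (- (Cmod (schwarzian f (g x)) * (Cmod (g1 x) * (1 - x ^ 2)) ^ 2 / 2)) by field.
    lra.
  - unfold g. rewrite geodesic_0. ring.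
  - unfold g, lam, t. rewrite geodesic_end, Hfab by auto. ring.
Qed.

(** * Separation of points with equal values, and valence *)

(** On a short interval the weight (1-x^2)^2 is close to 1 and the comparison function
    1 - M x^2 is concave enough; its logarithmic derivative is replaced by its linear
    part -2Mx. The length 1/(2+2M) ensures both x <= 1/2 and 4 M x^2 <= 1. *)
Lemma pseudo_hyperbolic_separation (f : C -> C) (M : R) (a b : C) :
  analytic_on_disk f -> (forall z, unit_disk z -> C_derive f z <> 0%C) ->
  0 <= M -> schwarzian_norm_le f M ->
  unit_disk a -> unit_disk b -> a <> b -> f a = f b ->
  / (2 + 2 * M) < pseudo_hyperbolic a b.
Proof.
  intros Hf Hd HM HS Ha Hb Hab Hfab.
  assert (P := pseudo_hyperbolic_bounds a b Ha Hb Hab).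
  apply Rnot_le_lt. intros Hle.
  assert (Hx : forall x, 0 <= x <= pseudo_hyperbolic a b -> x * (2 + 2 * M) <= 1).
  { intros x Hx. apply Rle_trans with (/ (2 + 2 * M) * (2 + 2 * M)).
    - apply Rmult_le_compat_r; lra.
    - rewrite Rinv_l; lra. }
  apply (geodesic_comparison f a b M (fun x => - (2 * M * x)) (fun _ => - (2 * M)));
    auto.
  - intros x Hx0 z. apply HS. apply geodesic_in_disk; auto.
    + apply Cmod_geo_direction; auto.
    + rewrite Rabs_pos_eq; lra.
  - intros x Hx0. specialize (Hx x Hx0). split.
    + auto_derive; [auto|ring].
    + assert (X1 : 0 <= x * M) by (apply Rmult_le_pos; lra).
      assert (X2 : x <= 1 / 2) by lra.
      assert (X3 : x * M <= 1 / 2) by lra.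
      assert (X4 : 4 * M * x ^ 2 <= 1) by nra.
      assert (X5 : - (2 * M) + (- (2 * M * x)) ^ 2 <= - M).
      { replace (- (2 * M) + (- (2 * M * x)) ^ 2) with (- (2 * M) + M * (4 * M * x ^ 2)) by ring.
        assert (M * (4 * M * x ^ 2) <= M * 1) by (apply Rmult_le_compat_l; lra). lra. }
      assert (X6 : 3 / 4 <= 1 - x ^ 2) by nra.
      assert (X7 : 1 / 2 <= (1 - x ^ 2) ^ 2) by nra.
      apply Rle_trans with (- M * (1 - x ^ 2) ^ 2); [|nra].
      apply Rmult_le_compat_r; lra.
Qed.

Lemma hyperbolic_dist_lower (a b : C) (r : R) :
  unit_disk a -> unit_disk b -> a <> b -> 0 <= r -> r <= pseudo_hyperbolic a b ->
  1 / 2 * ln (1 + r) <= hyperbolic_dist a b.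
Proof.
  intros Ha Hb Hab Hr Hle. assert (P := pseudo_hyperbolic_bounds a b Ha Hb Hab).
  unfold hyperbolic_dist. apply Rmult_le_compat_l; [lra|].
  apply ln_le; [lra|].
  apply (Rmult_le_reg_r (1 - pseudo_hyperbolic a b)); [lra|].
  unfold Rdiv. rewrite Rmult_assoc, Rinv_l by lra. nra.
Qed.

(** If [a] is not close to the unit circle, pseudo-hyperbolic and Euclidean distances
    from [a] are comparable. If it is, the geodesic from [a] to [b] must enter the disk
    |z| < r0: outside that disk the Schwarzian norm is at most 2 and Nehari's comparison
    function sqrt (1-x^2), which has no zero, excludes a second zero. Then [b] lies at
    Euclidean distance more than |a| - r0 from [a]. *)
Lemma euclidean_separation (f : C -> C) (M r0 : R) (a b : C) :
  analytic_on_disk f -> (forall z, unit_disk z -> C_derive f z <> 0%C) ->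
  0 <= M -> schwarzian_norm_le f M ->
  0 <= r0 < 1 ->
  (forall z, unit_disk z -> r0 <= Cmod z ->
     Cmod (schwarzian f z) * (1 - Cmod z ^ 2) ^ 2 <= 2) ->
  unit_disk a -> unit_disk b -> a <> b -> f a = f b ->
  / (2 + 2 * M) * ((1 - r0) / 2) <= Cmod (a - b)%C.
Proof.
  intros Hf Hd HM HS Hr0 H2 Ha Hb Hab Hfab.
  assert (P := pseudo_hyperbolic_bounds a b Ha Hb Hab).
  assert (S := pseudo_hyperbolic_separation f M a b Hf Hd HM HS Ha Hb Hab Hfab).
  assert (I : 0 < / (2 + 2 * M)) by (apply Rinv_0_lt_compat; lra).
  destruct (Rle_lt_dec (Cmod a) ((1 + r0) / 2)) as [Hs|Hl].
  - assert (N := one_sub_conj_neq_0 a b Ha Hb).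
    assert (E : Cmod (a - b)%C = pseudo_hyperbolic a b * Cmod (1 - Cconj a * b)%C).
    { unfold pseudo_hyperbolic. rewrite <- Cmod_mult. f_equal. field. exact N. }
    rewrite E. apply Rmult_le_compat; [lra|lra|lra|].
    assert (T := Cmod_triangle_rev 1 (Cconj a * b)%C).
    rewrite Cmod_1, Cmod_mult, Cmod_conj in T.
    eapply Rle_trans; [|exact T]. eapply Rle_trans; [|apply Rle_abs].
    unfold unit_disk in *. assert (A1 := Cmod_ge_0 a). assert (A2 := Cmod_ge_0 b). nra.
  - assert (L := Cmod_geo_direction a b Ha Hb Hab).
    assert (Ex : exists x, 0 <= x <= pseudo_hyperbolic a b /\
       Cmod (geodesic a (geo_direction a b) x) < r0).
    { apply NNPP. intros N.
      (* the logarithmic derivative of sqrt (1-x^2), with equality in the Riccati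
         inequality *)
      apply (geodesic_comparison f a b 2 (fun x => - (x / (1 - x ^ 2)))
        (fun x => - ((1 + x ^ 2) / (1 - x ^ 2) ^ 2))); auto.
      - intros x Hx z. apply H2.
        + apply geodesic_in_disk; auto. rewrite Rabs_pos_eq; lra.
        + apply Rnot_lt_le. intros Hlt. apply N. exists x. auto.
      - intros x Hx. assert (D : 0 < 1 - x ^ 2) by nra. split.
        + auto_derive; [lra|field; lra].
        + apply Req_le. field. lra. }
    destruct Ex as [x [Hx Hlt]].
    assert (G := geodesic_dist_start a (geo_direction a b) Ha L x _ Hx (proj2 P)).
    rewrite geodesic_end in G by auto.
    assert (T := Cmod_triangle_rev a (geodesic a (geo_direction a b) x)).
    assert (T2 := Rle_abs (Cmod a - Cmod (geodesic a (geo_direction a b) x))).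
    replace (a - geodesic a (geo_direction a b) x)%C
      with (- (geodesic a (geo_direction a b) x - a))%C in T by ring.
    replace (a - b)%C with (- (b - a))%C by ring. rewrite Cmod_opp in *.
    apply Rle_trans with ((1 - r0) / 2); [|lra].
    rewrite <- (Rmult_1_l ((1 - r0) / 2)) at 2.
    apply Rmult_le_compat_r; [lra|]. lra.
Qed.

Definition grid_index (k : nat) (x : R) : nat := Z.to_nat (Int_part ((x + 1) * INR k)).

Lemma grid_index_spec (k : nat) (x : R) : -1 < x < 1 -> (0 < k)%nat ->
  INR (grid_index k x) <= (x + 1) * INR k < INR (grid_index k x) + 1 /\
  (grid_index k x < 2 * k)%nat.
Proof.
  intros Hx Hk. apply lt_0_INR in Hk.
  destruct (base_Int_part ((x + 1) * INR k)) as [B1 B2].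
  assert (P : 0 <= (x + 1) * INR k) by nra.
  assert (Z0 : (0 <= Int_part ((x + 1) * INR k))%Z).
  { assert (-1 < Int_part ((x + 1) * INR k))%Z; [|lia]. apply lt_IZR. lra. }
  assert (E : INR (grid_index k x) = IZR (Int_part ((x + 1) * INR k))).
  { unfold grid_index. rewrite INR_IZR_INZ, Z2Nat.id by exact Z0. reflexivity. }
  rewrite E. split; [lra|].
  apply INR_lt. rewrite E, mult_INR. simpl (INR 2). nra.
Qed.

(** Pigeonhole: two points in the same cell of a square grid of mesh 1/k are less than
    2/k < delta apart, so the list injects into the 4k^2 cells covering the disk. *)
Lemma packing (delta : R) : 0 < delta ->
  exists N : nat, forall l : list C, NoDup l ->
    (forall z, In z l -> unit_disk z) ->
    (forall z w, In z l -> In w l -> z <> w -> delta <= Cmod (z - w)%C) ->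
    (length l <= N)%nat.
Proof.
  intros Hd.
  destruct (INR_unbounded (2 / delta)) as [k Hk].
  assert (Hk0 : 0 < INR k).
  { apply Rlt_trans with (2 := Hk). apply Rdiv_lt_0_compat; lra. }
  assert (Hkn : (0 < k)%nat) by (apply INR_lt; exact Hk0).
  assert (Hkd : 2 < delta * INR k).
  { apply (Rmult_gt_compat_l delta) in Hk; [|lra]. 
    replace (delta * (2 / delta)) with 2 in Hk by (field; lra). lra. }
  set (cell := fun z : C => (grid_index k (Re z), grid_index k (Im z))).
  set (cells := list_prod (seq 0 (2 * k)) (seq 0 (2 * k))).
  exists (length cells). intros l Hl Hu Hsep.
  assert (parts : forall z, In z l -> -1 < Re z < 1 /\ -1 < Im z < 1).
  { intros z Hz. assert (U := Hu z Hz). unfold unit_disk in U.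
    assert (A1 := re_le_Cmod z). assert (A2 := Rabs_Im_le z).
    apply Rabs_le_between in A1, A2. lra. }
  assert (inj : forall z w, In z l -> In w l -> cell z = cell w -> z = w).
  { intros z w Hz Hw E. apply NNPP. intros N.
    assert (D := Hsep z w Hz Hw N). injection E as E1 E2.
    destruct (parts z Hz) as [Z1 Z2]. destruct (parts w Hw) as [W1 W2].
    destruct (grid_index_spec k _ Z1 Hkn) as [G1 _].
    destruct (grid_index_spec k _ Z2 Hkn) as [G2 _].
    destruct (grid_index_spec k _ W1 Hkn) as [G3 _].
    destruct (grid_index_spec k _ W2 Hkn) as [G4 _].
    rewrite E1 in G1. rewrite E2 in G2.
    assert (T := Cmod_le_parts (z - w)%C).
    assert (K1 : Rabs (Re (z - w)%C) * INR k <= 1).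
    { rewrite <- (Rabs_pos_eq (INR k)) by lra. rewrite <- Rabs_mult.
      apply Rabs_le. unfold Re in *. simpl. lra. }
    assert (K2 : Rabs (Im (z - w)%C) * INR k <= 1).
    { rewrite <- (Rabs_pos_eq (INR k)) by lra. rewrite <- Rabs_mult.
      apply Rabs_le. unfold Im in *. simpl. lra. }
    nra. }
  rewrite <- (length_map cell). apply NoDup_incl_length.
  - clear Hu Hsep parts. induction Hl as [|z l Hz Hl IH]; simpl; constructor.
    + intros Hin. apply in_map_iff in Hin. destruct Hin as [w [E Hw]].
      apply Hz. rewrite <- (inj w z); simpl; auto.
    + apply IH. intros; apply inj; simpl; auto.
  - intros q Hq. apply in_map_iff in Hq. destruct Hq as [z [<- Hz]].
    destruct (parts z Hz) as [Z1 Z2].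
    apply in_prod; apply in_seq; split; try lia; apply grid_index_spec; assumption.
Qed.

Lemma valence_le (f : C -> C) (N : nat) :
  (forall (w : C) (l : list C), NoDup l ->
     (forall z, In z l -> unit_disk z /\ f z = w) -> (length l <= N)%nat) ->
  Rbar_le (valence f) (INR N).
Proof.
  intros H. unfold valence, Rbar_lub.
  destruct (Rbar_ex_lub _) as [v [Hub Hv]]. simpl. apply Hv.
  intros v' [w ->]. unfold preimage_count, card.
  apply Lub_Rbar_correct. intros x [l [Hl [Hin ->]]].
  simpl. apply le_INR. apply (H w); auto.
Qed.

(** The weight (1-x^2)^2 p(x) is largest at x = 0. *)
Lemma nehari_norm_le (p : R -> R) (c : R) (f : C -> C) : nehari_function p -> 0 <= c ->
  (forall z, unit_disk z -> Cmod (schwarzian f z) <= c * p (Cmod z)) ->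
  schwarzian_norm_le f (c * p 0).
Proof.
  intros [_ [_ [_ [Hmono _]]]] Hc HS z Hz.
  assert (A := Cmod_ge_0 z).
  assert (H := Hmono 0 (Cmod z) ltac:(lra) A Hz).
  apply Rle_trans with (c * p (Cmod z) * (1 - Cmod z ^ 2) ^ 2).
  - apply Rmult_le_compat_r; [apply pow2_ge_0|auto].
  - replace ((1 - 0 ^ 2) ^ 2 * p 0) with (p 0) in H by ring. nra.
Qed.

Theorem theorem1 (p : R -> R) (mu c : R)
  (Hp : nehari_function p)
  (Hlim : filterlim (fun x : R => (1 - x ^ 2) ^ 2 * p x) (at_left 1) (locally mu))
  (Hmu : 0 <= mu < 1)
  (Hc : 2 < c) :
  (forall f : C -> C,
     analytic_on_disk f ->
     locally_univalent_on_disk f ->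
     (forall z : C, unit_disk z -> Cmod (schwarzian f z) <= c * p (Cmod z)) ->
     uniformly_locally_univalent f) /\
  (c * mu < 2 ->
   exists N : nat, forall f : C -> C,
     analytic_on_disk f ->
     locally_univalent_on_disk f ->
     (forall z : C, unit_disk z -> Cmod (schwarzian f z) <= c * p (Cmod z)) ->
     Rbar_le (valence f) (INR N)).
Proof.
  assert (p0 : 0 < p 0) by (apply Hp; lra).
  set (M := c * p 0). assert (HM : 0 <= M) by (unfold M; nra).
  assert (I : 0 < / (2 + 2 * M)) by (apply Rinv_0_lt_compat; lra).
  split.
  - intros f Hf Hu HS.
    assert (HN := nehari_norm_le p c f Hp ltac:(lra) HS). fold M in HN.
    exists (1 / 2 * ln (1 + / (2 + 2 * M))). split.
    { apply Rmult_lt_0_compat; [lra|]. rewrite <- ln_1. apply ln_increasing; lra. }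
    intros a b Ha Hb Hab Hfab. apply hyperbolic_dist_lower; auto; [lra|].
    left. apply (pseudo_hyperbolic_separation f); auto.
    apply (derivative_nonzero f M); auto.
  - intros Hcmu.
    assert (Er : exists r0, 0 <= r0 < 1 /\
       forall x, r0 <= x < 1 -> c * ((1 - x ^ 2) ^ 2 * p x) <= 2).
    { assert (He : 0 < 2 / c - mu).
      { apply (Rmult_lt_reg_l c); [lra|]. field_simplify; lra. }
      destruct (Hlim _ (locally_ball mu (mkposreal _ He))) as [d Hd].
      assert (A1 := Rmin_l 1 d). assert (A2 := Rmin_r 1 d).
      assert (A3 : 0 < Rmin 1 d) by (apply Rmin_glb_lt; [lra|apply cond_pos]).
      exists (1 - Rmin 1 d / 2). split; [lra|]. intros x Hx.
      assert (B : ball 1 d x).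
      { change (Rabs (x - 1) < d). rewrite Rabs_left1; lra. }
      specialize (Hd x B (proj2 Hx)).
      change (Rabs ((1 - x ^ 2) ^ 2 * p x - mu) < 2 / c - mu) in Hd.
      apply Rabs_def2 in Hd.
      apply Rle_trans with (c * (2 / c)); [|right; field; lra].
      apply Rmult_le_compat_l; lra. }
    destruct Er as [r0 [Hr0 H2]].
    destruct (packing (/ (2 + 2 * M) * ((1 - r0) / 2))) as [N HN].
    { apply Rmult_lt_0_compat; lra. }
    exists N. intros f Hf Hu HS.
    assert (Hn := nehari_norm_le p c f Hp ltac:(lra) HS). fold M in Hn.
    apply valence_le. intros w l Hl Hin. apply HN; auto.
    + intros z Hz. apply Hin, Hz.
    + intros a b Ha Hb Hab.
      destruct (Hin a Ha) as [Ua Fa]. destruct (Hin b Hb) as [Ub Fb].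
      apply (euclidean_separation f); auto; [|intros z Hz Hle|congruence].
      * apply (derivative_nonzero f M); auto.
      * eapply Rle_trans; [|apply (H2 (Cmod z)); split; assumption].
        rewrite (Rmult_comm ((1 - _) ^ 2)), <- Rmult_assoc.
        apply Rmult_le_compat_r; [apply pow2_ge_0|auto].
Qed.
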